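(* Let $\mathcal{D}$ be the cluster category of Dynkin type $A_\infty$ over an algebraically closed field $k$, let $n\in\mathbb{Z}$, and let $\mathcal{T}$ be the cluster tilting subcategory of $\mathcal{D}$ corresponding to the maximal collection of non-crossing arcs $$\mathfrak{T}=\{(m,n)\mid m\le n-2\}\cup\{(n,p)\mid p\ge n+2\}.$$ Put $T=\operatorname{ind}\mathcal{T}$. Then there is no cluster map $\rho:\operatorname{obj}\mathcal{D}\to\mathbb{Q}(x_t)_{t\in T}$ satisfying the following conditions: (i) $\rho(t)=x_t$ for $t\in T$; (ii) if $d\in\mathcal{D}$, then $\rho(d)$ is a non-zero Laurent polynomial in the variables $x_t$; (iii) in each such Laurent polynomial, the coefficients in the numerator are positive integers.
   Context: The category $\mathcal{D}$ (Holm--Jørgensen). $\mathcal{D}$ is the (up to equivalence unique) $k$-linear algebraic triangulated category with split idempotents which is classically generated by a $2$-spherical object $s$, i.e. $\mathcal{D}(s,\Sigma^is)$ is $k$ for $i=0,2$ and $0$ otherwise. It is $\operatorname{Hom}$-finite, Krull--Schmidt and $2$-Calabi--Yau, with shift functor $\Sigma$; $\operatorname{Ext}^1(x,y)=\mathcal{D}(x,\Sigma y)$. Its Auslander--Reiten (AR) quiver is $\mathbb{Z}A_\infty$, with a coordinate system in which the indecomposable objects are the pairs $(m,n)$ of integers with $m\le n-2$, the arrows are $(m,n)\to(m,n+1)$ and $(m,n)\to(m+1,n)$ (when defined), and $\Sigma(m,n)=(m-1,n-1)$. The pair $(m,n)$ is also viewed as an arc connecting the non-neighbouring integers $m,n$.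 Two arcs $(m,n)$, $(p,q)$ cross if $m<p<n<q$ or $p<m<q<n$. A set of indecomposables is $\operatorname{ind}\mathcal{T}$ for a cluster tilting subcategory $\mathcal{T}$ iff the corresponding set $\mathfrak{T}$ of arcs is a maximal collection of non-crossing arcs which either is locally finite (for each integer $n$ only finitely many arcs $(m,n)$ and $(n,p)$ are in $\mathfrak{T}$) or has a fountain (for some $n$, infinitely many arcs $(m,n)$ and infinitely many arcs $(n,p)$ are in $\mathfrak{T}$). Cluster tilting and mutation. A cluster tilting subcategory is a full functorially finite subcategory $\mathcal{T}$, closed under finite direct sums, summands and isomorphisms, such that $c\in\mathcal{T}$ iff $\mathcal{D}(t,\Sigma c)=0$ for all $t\in\mathcal{T}$ iff $\mathcal{D}(c,\Sigma t)=0$ for all $t\in\mathcal{T}$. $\operatorname{ind}\mathcal{T}$ is its set of isomorphism classes of indecomposables. For $t\in\operatorname{ind}\mathcal{T}'$ there is a unique indecomposable $t^*\not\cong t$ such that $\operatorname{add}((\operatorname{ind}\mathcal{T}'\setminus t)\cup t^* )$ is cluster tilting (the mutation of $\mathcal{T}'$ at $t$); ''reachable from $\mathcal{T}$'' means obtained by finitely many mutations. Cluster map. The $x_t$, $t\in T$, are independent variables. A map $\rho:\operatorname{obj}\mathcal{D}\to\mathbb{Q}(x_t)_{t\in T}$ is a cluster map if: (1) it is constant on isomorphism classes; (2) $\rho(c_1\oplus c_2)=\rho(c_1)\rho(c_2)$ for all $c_1,c_2\in\mathcal{D}$; (3) if $m,\ell\in\mathcal{D}$ are indecomposable with $\dim_k\operatorname{Ext}^1(m,\ell)=1$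 and $b,b'\in\mathcal{D}$ are such that there are non-split distinguished triangles $m\to b\to\ell$ and $\ell\to b'\to m$, then $\rho(m)\rho(\ell)=\rho(b)+\rho(b')$; (4) there is a cluster tilting subcategory $\mathcal{T}'$ reachable from $\mathcal{T}$ for which $\{\rho(t')\mid t'\in\operatorname{ind}\mathcal{T}'\}$ is a transcendence basis of $\mathbb{Q}(x_t)_{t\in T}$. *)

(* Defs.v *)
From HB Require Import structures.
From mathcomp Require Import all_boot all_order all_algebra finmap.
From mathcomp.multinomials Require Import monalg.
Set Implicit Arguments.
Unset Strict Implicit.
Unset Printing Implicit Defensive.
Import Order.TTheory GRing.Theory Num.Theory.
Local Open Scope ring_scope.

(* Polynomials with rational coefficients in the possibly infinitely many
   variables indexed by I.  multinomials provides the commutative ring; the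
   first section below shows that it is an integral domain, so that its field
   of fractions Q(x_i)_(i in I) is available as ratfun I. *)
Notation ratpoly I := {malg rat[{cmonom I}]}.

Section RatPolyDomain.
Variable I : choiceType.
Implicit Types (e : seq I) (m : {cmonom I}) (g h : ratpoly I).

Definition kweight (N : nat) e m := foldr (fun i a => (m i + N * a)%N) 0%N e.

Lemma kweight1 N e : kweight N e (@mone _) = 0%N.
Proof. by elim: e => //= i e ->; rewrite cm1 muln0. Qed.

Lemma kweightM N e m1 m2 :
  kweight N e (mmul m1 m2) = (kweight N e m1 + kweight N e m2)%N.
Proof. by elim: e => //= i e ->; rewrite cmM mulnDr addnACA. Qed.

Lemma kweight_inj N e m1 m2 :
  (forall i, m1 i < N)%N -> (forall i, m2 i < N)%N ->
  kweight N e m1 = kweight N e m2 -> {in e, forall i, m1 i = m2 i}.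
Proof.
move=> lt1 lt2; elim: e => //= i e IHe eqW.
have N0 : (0 < N)%N by apply: leq_ltn_trans (lt1 i).
have eqi : m1 i = m2 i.
  move/(congr1 (modn^~ N)): eqW.
  by rewrite ![(N * _)%N]mulnC ![(_ + _ * N)%N]addnC !modnMDl !modn_small.
move=> j; rewrite inE => /orP [/eqP->//|]; apply: IHe.
by move: eqW; rewrite eqi => /addnI /eqP; rewrite eqn_pmul2l // => /eqP.
Qed.

Definition kmono N e m : {poly rat} := 'X^(kweight N e m).

Lemma kmono_mmorphism N e : mmorphism (kmono N e).
Proof. by split=> [m1 m2|]; rewrite /kmono ?kweight1 ?expr0 // kweightM exprD. Qed.

HB.instance Definition _ N e :=
  isMultiplicative.Build {cmonom I} {poly rat} (kmono N e) (kmono_mmorphism N e).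

(* Kronecker substitution: injective on a given polynomial for N, e large. *)
Definition kronecker N e : {malg rat[{cmonom I}]} -> {poly rat} :=
  mmap (@polyC rat) (kmono N e).

Lemma kroneckerM N e g h :
  kronecker N e (g * h) = kronecker N e g * kronecker N e h.
Proof. exact: rmorphM. Qed.

Lemma coef_kronecker N e g j :
  (kronecker N e g)`_j = \sum_(m <- msupp g) g@_m *+ (kweight N e m == j).
Proof.
rewrite /kronecker /mmap coef_sum; apply: eq_bigr => m _.
by rewrite /kmono coefCM coefXn eq_sym mulr_natr.
Qed.

Lemma kronecker_sep (s : seq {cmonom I}) :
  exists N e, {in s &, injective (kweight N e)}.
Proof.
pose e := flatten [seq enum_fset (finsupp (cmonom_val m)) | m <- s].
pose N := (\max_(m <- s) \max_(i <- e) (cmonom_val m) i).+1.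
have out m i : m \in s -> i \notin e -> m i = 0%N.
  move=> ms; apply: contraNeq; rewrite cmE_neq0 => mi.
  by apply/flattenP; exists (enum_fset (finsupp (cmonom_val m))) => //; apply/mapP; exists m.
have lt m i : m \in s -> (m i < N)%N.
  move=> ms; rewrite /N ltnS; case: (boolP (i \in e)) => [ie|/(out _ _ ms) -> //].
  have le_i : (m i <= \max_(j <- e) cmonom_val m j)%N by rewrite leq_bigmax_seq.
  by apply: leq_trans le_i _; rewrite (leq_bigmax_seq m).
exists N, e => m1 m2 s1 s2 eqW; apply/eqP/cmP => i.
case: (boolP (i \in e)) => [ie|nie]; last by rewrite !out.
by apply: (kweight_inj _ _ eqW) => // j; apply: lt.
Qed.

Lemma coef_kronecker_sep N e (s : seq {cmonom I}) g m :
    {in s &, injective (kweight N e)} -> {subset msupp g <= s} -> m \in s ->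
  (kronecker N e g)`_(kweight N e m) = g@_m.
Proof.
move=> inj sub ms; rewrite coef_kronecker.
case: (boolP (m \in msupp g)) => [mg|nmg].
  rewrite (bigD1_seq m) ?fset_uniq // eqxx mulr1n big1_seq => [|m' /andP [ne m'g]].
    exact: addr0.
  case: eqP => // /inj eqm; case/eqP: ne; apply: eqm => //; exact: sub.
rewrite mcoeff_outdom // big1_seq // => m' /andP [_ m'g].
case: eqP => // /inj eqm; case/negP: nmg.
by rewrite -(eqm _ ms) //; apply: sub.
Qed.

Lemma ratpoly_mulf_eq0 g h : g * h = 0 -> (g == 0) || (h == 0).
Proof.
move=> gh0; have [N [e inj]] := kronecker_sep (msupp g ++ msupp h).
have : kronecker N e g * kronecker N e h = 0.
  by rewrite -kroneckerM gh0 /kronecker raddf0.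
have van (f : ratpoly I) : {subset msupp f <= msupp g ++ msupp h} ->
    kronecker N e f = 0 -> f = 0.
  move=> sub f0; apply/malgP => m; rewrite mcoeff0.
  case: (boolP (m \in msupp f)) => [mf|/mcoeff_outdom //].
  by rewrite -(coef_kronecker_sep inj sub (sub _ mf)) f0 coef0.
move/eqP; rewrite mulf_eq0 => /orP [] /eqP z; apply/orP; [left|right]; apply/eqP;
  by apply: van z => m mf; rewrite mem_cat mf ?orbT.
Qed.

(* The units are the nonzero constants. *)
Definition ratpoly_unit : {pred ratpoly I} :=
  fun g => (g@_(@mone _) != 0) && (g == (g@_(@mone _))%:MP).

Definition ratpoly_inv g : ratpoly I :=
  if g \in ratpoly_unit then (g@_(@mone _))^-1%:MP else g.

Lemma ratpoly_mulVr : {in ratpoly_unit, left_inverse 1 ratpoly_inv *%R}.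
Proof.
move=> g gU; rewrite /ratpoly_inv gU; move: gU => /andP [c0 /eqP {2}->].
by rewrite -mpolyCM mulVf // mpolyC1E.
Qed.

Lemma ratpoly_unitP g h : h * g = 1 -> g \in ratpoly_unit.
Proof.
move=> hg1; have [N [e inj]] := kronecker_sep (@mone _ :: msupp g).
have K1 : kronecker N e h * kronecker N e g = 1.
  by rewrite -kroneckerM hg1 /kronecker rmorph1.
have sg1 : size (kronecker N e g) = 1%N.
  by apply/eqP; move: (size_poly1 rat); rewrite -K1 => /eqP; rewrite size_mul_eq1 => /andP [].
have sub : {subset msupp g <= @mone _ :: msupp g}.
  by move=> m mg; rewrite inE mg orbT.
have cst : g = (g@_(@mone _))%:MP.
  apply/malgP => m; rewrite mcoeffC; case: eqP => [->//|/eqP m1].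
  case: (boolP (m \in msupp g)) => [mg|/mcoeff_outdom //].
  rewrite mulr0n -(coef_kronecker_sep inj sub (sub _ mg)) nth_default // sg1 lt0n.
  rewrite -(kweight1 N e); apply: contra m1 => /eqP /inj eqm.
  by apply/eqP; apply: eqm; [exact: sub|exact: mem_head].
rewrite /ratpoly_unit unfold_in -cst eqxx andbT.
apply/eqP => g0; move: hg1; rewrite cst g0 malgC0E mulr0.
by move/eqP; rewrite eq_sym oner_eq0.
Qed.

Lemma ratpoly_inv_out : {in [predC ratpoly_unit], ratpoly_inv =1 id}.
Proof. by move=> g; rewrite inE /ratpoly_inv => /negbTE ->. Qed.

HB.instance Definition _ :=
  GRing.ComNzRing_hasMulInverse.Build (ratpoly I)
    ratpoly_mulVr ratpoly_unitP ratpoly_inv_out.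

HB.instance Definition _ :=
  GRing.ComUnitRing_isIntegral.Build (ratpoly I) ratpoly_mulf_eq0.

End RatPolyDomain.

Notation ratfun I := {fraction ratpoly I}.

Section LaurentPolynomials.
Variable I : choiceType.

Definition ratfun_var (i : I) : ratfun I := tofrac (<< ucm i >> : ratpoly I).

(* f is the quotient of the polynomial p by the monomial m. *)
Definition laurent_form (f : ratfun I) (p : ratpoly I) (m : {cmonom I}) : Prop :=
  f = tofrac p / tofrac (<< m >> : ratpoly I).

Definition is_laurent (f : ratfun I) : Prop := exists p m, laurent_form f p m.

(* The nonzero coefficients of a numerator depend neither on the choice of the
   numerator nor on that of the denominator, up to relabelling of monomials. *)
Definition positive_numerators (f : ratfun I) : Prop :=
  forall p m, laurent_form f p m ->
  forall mu, mu \in msupp p -> exists2 c : nat, (0 < c)%N & p@_mu = c%:R.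

End LaurentPolynomials.

Section TranscendenceBases.
Variable F : fieldType.
Implicit Types (B S : F -> Prop) (z : F).

Definition rateval (n : nat) (b : 'I_n -> F) (p : ratpoly 'I_n) : F :=
  mmap (ratr : rat -> F) (fun m : {cmonom 'I_n} => \prod_i b i ^+ m i) p.

Definition alg_independent B : Prop :=
  forall (n : nat) (b : 'I_n -> F), injective b -> (forall i, B (b i)) ->
  forall p : ratpoly 'I_n, rateval b p = 0 -> p = 0.

Definition is_subfield S : Prop :=
  [/\ S 1, forall x y, S x -> S y -> S (x - y)
    & forall x y, S x -> S y -> S (x / y)].

Definition gen_subfield B z : Prop :=
  forall S, is_subfield S -> (forall y, B y -> S y) -> S z.

Definition algebraic_over S z : Prop :=
  exists p : {poly F}, [/\ p != 0, forall i, S p`_i & root p z].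

(* Transcendence basis of F over its prime field Q. *)
Definition transcendence_basis B : Prop :=
  alg_independent B /\ forall z, algebraic_over (gen_subfield B) z.

End TranscendenceBases.

Definition has_dim (k : fieldType) (V : lmodType k) (d : nat) : Prop :=
  exists b : 'I_d -> V,
  forall v, exists! c : 'rV[k]_d, v = \sum_i c ord0 i *: b i.

Record lincat (k : fieldType) := LinCat {
  obj :> Type;
  hom : obj -> obj -> lmodType k;
  idm : forall x, hom x x;
  mcomp : forall x y z, hom y z -> hom x y -> hom x z;
  comp1m : forall x y (f : hom x y), mcomp (idm y) f = f;
  compm1 : forall x y (f : hom x y), mcomp f (idm x) = f;
  compmA : forall w x y z (h : hom y z) (g : hom x y) (f : hom w x),
    mcomp h (mcomp g f) = mcomp (mcomp h g) f;
  comp_linearl : forall x y z (f : hom x y) a (g g' : hom y z),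
    mcomp (a *: g + g') f = a *: mcomp g f + mcomp g' f;
  comp_linearr : forall x y z (g : hom y z) a (f f' : hom x y),
    mcomp g (a *: f + f') = a *: mcomp g f + mcomp g f'
}.

Declare Scope cat_scope.
Delimit Scope cat_scope with cat.
Notation "g ** f" := (mcomp g f) (at level 40, left associativity) : cat_scope.
Local Open Scope cat_scope.

Section LinearCategories.
Variables (k : fieldType) (C : lincat k).
Implicit Types x y z : C.

Definition is_iso x y (f : hom x y) : Prop :=
  exists g : hom y x, g ** f = idm x /\ f ** g = idm y.

Definition isomorphic x y : Prop := exists f : hom x y, is_iso f.

Definition is_zero x : Prop := idm x = 0.

(* z is a direct sum of x and y. *)
Definition biproduct x y z : Prop :=
  exists (i1 : hom x z) (i2 : hom y z) (p1 : hom z x) (p2 : hom z y),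
  [/\ p1 ** i1 = idm x, p2 ** i2 = idm y, p1 ** i2 = 0, p2 ** i1 = 0
    & i1 ** p1 + i2 ** p2 = idm z].

Definition additive_cat : Prop :=
  (exists z, is_zero z) /\ (forall x y, exists z, biproduct x y z).

Definition split_idempotents : Prop :=
  forall x (e : hom x x), e ** e = e ->
  exists y (i : hom y x) (p : hom x y), i ** p = e /\ p ** i = idm y.

Definition indecomposable x : Prop :=
  ~ is_zero x /\ forall y z, biproduct y z x -> is_zero y \/ is_zero z.

(* The closure of P under isomorphisms, finite direct sums and summands. *)
Inductive add_closure (P : C -> Prop) : C -> Prop :=
| AddBase x of P x : add_closure P x
| AddZero x of is_zero x : add_closure P x
| AddSum x y z of biproduct x y z & add_closure P x & add_closure P y :
    add_closure P z
| AddSummand x y z of biproduct x y z & add_closure P z : add_closure P x.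

Definition rad x y (f : hom x y) : Prop :=
  forall g : hom y x, is_iso (idm x - g ** f).

(* In an additive category, finite sums of composites g ** f of radical
   morphisms are again of this form. *)
Definition rad2 x y (f : hom x y) : Prop :=
  exists z (g : hom z y) (h : hom x z), [/\ rad g, rad h & f = g ** h].

(* dim_k rad(x, y) / rad^2(x, y) = d.  Over an algebraically closed field
   this is the number of arrows from x to y in the Auslander-Reiten quiver. *)
Definition irr_dim x y (d : nat) : Prop :=
  exists b : 'I_d -> hom x y, (forall i, rad (b i)) /\
  forall f, rad f -> exists! c : 'rV[k]_d, rad2 (f - \sum_i c ord0 i *: b i).

Definition is_kernel x y z (i : hom x y) (p : hom y z) : Prop :=
  p ** i = 0 /\
  forall w (f : hom w y), p ** f = 0 -> exists! g : hom w x, i ** g = f.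

Definition is_cokernel x y z (i : hom x y) (p : hom y z) : Prop :=
  p ** i = 0 /\
  forall w (f : hom y w), f ** i = 0 -> exists! g : hom z w, g ** p = f.

Definition is_pullback x y z w
    (p : hom y z) (f : hom x z) (p' : hom w x) (f' : hom w y) : Prop :=
  p ** f' = f ** p' /\
  forall v (a : hom v y) (b : hom v x), p ** a = f ** b ->
  exists! u : hom v w, f' ** u = a /\ p' ** u = b.

Definition is_pushout x y z w
    (i : hom x y) (f : hom x z) (i' : hom z w) (f' : hom y w) : Prop :=
  f' ** i = i' ** f /\
  forall v (a : hom y v) (b : hom z v), a ** i = b ** f ->
  exists! u : hom w v, u ** f' = a /\ u ** i' = b.

End LinearCategories.

Record linfunctor (k : fieldType) (C D : lincat k) := LinFunctor {
  map_obj :> C -> D;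
  map_hom : forall x y, hom x y -> hom (map_obj x) (map_obj y);
  map_linear : forall x y a (f g : hom x y),
    map_hom (a *: f + g) = a *: map_hom f + map_hom g;
  map_id : forall x, map_hom (idm x) = idm (map_obj x);
  map_comp : forall x y z (g : hom y z) (f : hom x y),
    map_hom (g ** f) = map_hom g ** map_hom f
}.

Section Functors.
Variables (k : fieldType) (C D : lincat k) (F : linfunctor C D).

Definition full : Prop :=
  forall x y (g : hom (F x) (F y)), exists f : hom x y, map_hom F f = g.

Definition faithful : Prop :=
  forall (x y : C) (f g : hom x y), map_hom F f = map_hom F g -> f = g.

Definition ess_surjective : Prop :=
  forall y : D, exists x : C, isomorphic (F x) y.

Definition equivalence : Prop := [/\ full, faithful & ess_surjective].

End Functors.

(* k-linear triangulated categories, with the axioms TR1 - TR4; the shift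
   functor is an autoequivalence and need not be strictly invertible. *)
Record tricat (k : fieldType) := TriCat {
  tri_cat :> lincat k;
  tri_additive : additive_cat tri_cat;
  susp : linfunctor tri_cat tri_cat;
  susp_equivalence : equivalence susp;
  dist : forall x y z : tri_cat,
    hom x y -> hom y z -> hom z (susp x) -> Prop;
  dist_iso : forall x y z (f : hom x y) (g : hom y z) (h : hom z (susp x))
      x' y' z' (f' : hom x' y') (g' : hom y' z') (h' : hom z' (susp x'))
      (a : hom x x') (b : hom y y') (c : hom z z'),
    is_iso a -> is_iso b -> is_iso c ->
    b ** f = f' ** a -> c ** g = g' ** b -> map_hom susp a ** h = h' ** c ->
    dist f g h -> dist f' g' h';
  dist_id : forall x z, is_zero z ->
    dist (idm x) (0 : hom x z) (0 : hom z (susp x));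
  dist_cone : forall x y (f : hom x y),
    exists z (g : hom y z) (h : hom z (susp x)), dist f g h;
  dist_rotate : forall x y z (f : hom x y) (g : hom y z) (h : hom z (susp x)),
    dist f g h <-> dist g h (- map_hom susp f);
  dist_morphism : forall x y z (f : hom x y) (g : hom y z) (h : hom z (susp x))
      x' y' z' (f' : hom x' y') (g' : hom y' z') (h' : hom z' (susp x'))
      (a : hom x x') (b : hom y y'),
    dist f g h -> dist f' g' h' -> b ** f = f' ** a ->
    exists c : hom z z', c ** g = g' ** b /\ map_hom susp a ** h = h' ** c;
  dist_octahedron : forall x y z x' y' z' (f : hom x y) (g : hom y z)
      (f1 : hom y z') (f2 : hom z' (susp x))
      (g1 : hom z x') (g2 : hom x' (susp y))
      (h1 : hom z y') (h2 : hom y' (susp x)),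
    dist f f1 f2 -> dist g g1 g2 -> dist (g ** f) h1 h2 ->
    exists (u : hom z' y') (v : hom y' x'),
    [/\ dist u v (map_hom susp f1 ** g2),
        u ** f1 = h1 ** g, h2 ** u = f2,
        v ** h1 = g1 & g2 ** v = map_hom susp f ** h2]
}.

(* Exact categories in the sense of Quillen. *)
Record exactcat (k : fieldType) := ExactCat {
  ex_cat :> lincat k;
  ex_additive : additive_cat ex_cat;
  conflation : forall x y z : ex_cat, hom x y -> hom y z -> Prop;
  inflation x y (i : hom x y) : Prop := exists z (p : hom y z), conflation i p;
  deflation y z (p : hom y z) : Prop := exists x (i : hom x y), conflation i p;
  conflation_exact : forall x y z (i : hom x y) (p : hom y z),
    conflation i p -> is_kernel i p /\ is_cokernel i p;
  conflation_iso : forall x y z (i : hom x y) (p : hom y z)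
      x' y' z' (i' : hom x' y') (p' : hom y' z')
      (a : hom x x') (b : hom y y') (c : hom z z'),
    is_iso a -> is_iso b -> is_iso c ->
    b ** i = i' ** a -> c ** p = p' ** b ->
    conflation i p -> conflation i' p';
  inflation_id : forall x, inflation (idm x);
  deflation_id : forall x, deflation (idm x);
  inflation_comp : forall x y z (j : hom y z) (i : hom x y),
    inflation j -> inflation i -> inflation (j ** i);
  deflation_comp : forall x y z (q : hom y z) (p : hom x y),
    deflation q -> deflation p -> deflation (q ** p);
  deflation_pullback : forall x y z (p : hom y z) (f : hom x z), deflation p ->
    exists w (p' : hom w x) (f' : hom w y), is_pullback p f p' f' /\ deflation p';
  inflation_pushout : forall x y z (i : hom x y) (f : hom x z), inflation i ->
    exists w (i' : hom z w) (f' : hom y w), is_pushout i f i' f' /\ inflation i'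
}.

Section FrobeniusCategories.
Variables (k : fieldType) (E : exactcat k).

Definition projective (q : E) : Prop :=
  forall (x y z : E) (i : hom x y) (p : hom y z), conflation i p ->
  forall f : hom q z, exists g : hom q y, p ** g = f.

Definition injective_obj (q : E) : Prop :=
  forall (x y z : E) (i : hom x y) (p : hom y z), conflation i p ->
  forall f : hom x q, exists g : hom y q, g ** i = f.

Definition frobenius : Prop :=
  [/\ forall z : E, exists (x y : E) (i : hom x y) (p : hom y z),
        projective y /\ conflation i p,
      forall x : E, exists (y z : E) (i : hom x y) (p : hom y z),
        injective_obj y /\ conflation i p
    & forall q : E, projective q <-> injective_obj q].

Definition factors_projective (x y : E) (f : hom x y) : Prop :=
  exists (q : E) (g : hom q y) (h : hom x q), projective q /\ f = g ** h.

End FrobeniusCategories.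

(* D is triangle equivalent to the stable category of a Frobenius category E.
   The equivalence is given by the functor F that it induces on E: F is full
   and essentially surjective, it kills exactly the morphisms that vanish in
   the stable category, and it sends conflations to distinguished triangles,
   naturally in the conflation.  Applying the naturality of delta to the
   conflations x -> I -> Omega^-1 x with I injective gives the natural
   isomorphism F (Omega^-1 x) ~ susp (F x), and the distinguished triangles of
   the stable category are those coming from conflations. *)
Definition algebraic (k : fieldType) (D : tricat k) : Prop :=
  exists (E : exactcat k) (F : linfunctor E D)
    (delta : forall (x y z : E) (i : hom x y) (p : hom y z),
       conflation i p -> hom (F z) (susp D (F x))),
  [/\ frobenius E,
      full F /\ ess_surjective F,
      forall (x y : E) (f : hom x y),
        map_hom F f = 0 <-> factors_projective f,
      forall (x y z : E) (i : hom x y) (p : hom y z) (c : conflation i p),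
        dist (map_hom F i) (map_hom F p) (delta x y z i p c)
    & forall (x y z : E) (i : hom x y) (p : hom y z) (c : conflation i p)
        (x' y' z' : E) (i' : hom x' y') (p' : hom y' z') (c' : conflation i' p')
        (a : hom x x') (b : hom y y') (d : hom z z'),
        b ** i = i' ** a -> d ** p = p' ** b ->
        map_hom (susp D) (map_hom F a) ** delta x y z i p c
          = delta x' y' z' i' p' c' ** map_hom F d].

Section TriangulatedCategories.
Variables (k : fieldType) (D : tricat k).
Implicit Types x y z s t : D.

(* D(x, Sigma^i y); as the shift need not be strictly invertible, for i < 0
   this is taken to be D(Sigma^-i x, y). *)
Definition hom_deg x y (i : int) : lmodType k :=
  match i with
  | Posz n => hom x (iter n (susp D) y)
  | Negz n => hom (iter n.+1 (susp D) x) y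
  end.

Definition spherical2 s : Prop :=
  forall i : int,
    has_dim (hom_deg s s i) (if (i == 0) || (i == 2) then 1%N else 0%N).

Definition thick (P : D -> Prop) : Prop :=
  [/\ forall x y, isomorphic x y -> P x -> P y,
      forall x, P x <-> P (susp D x),
      forall x y z (f : hom x y) (g : hom y z) (h : hom z (susp D x)),
        dist f g h -> P x -> P y -> P z
    & forall x y z, biproduct x y z -> P z -> P x].

Definition classical_generator s : Prop :=
  forall P : D -> Prop, thick P -> P s -> forall x, P x.

Definition functorially_finite (T : D -> Prop) : Prop :=
  (forall x, exists t (f : hom t x), T t /\
     forall t' (g : hom t' x), T t' -> exists h : hom t' t, g = f ** h) /\
  (forall x, exists t (f : hom x t), T t /\
     forall t' (g : hom x t'), T t' -> exists h : hom t t', g = h ** f).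

Definition cluster_tilting (T : D -> Prop) : Prop :=
  [/\ forall x, T x <-> add_closure T x,
      functorially_finite T,
      forall c, T c <-> (forall t, T t -> forall f : hom t (susp D c), f = 0)
    & forall c, T c <-> (forall t, T t -> forall f : hom c (susp D t), f = 0)].

Definition mutation (T T' : D -> Prop) : Prop :=
  exists t t',
  [/\ T t /\ indecomposable t,
      indecomposable t' /\ ~ isomorphic t' t,
      forall x, T' x <->
        add_closure
          (fun y => [/\ T y, indecomposable y & ~ isomorphic y t] \/ y = t') x
    & cluster_tilting T'].

Inductive reachable (T : D -> Prop) : (D -> Prop) -> Prop :=
| ReachRefl : reachable T T
| ReachStep T' T'' of reachable T T' & mutation T' T'' : reachable T T''.

Record cluster_map (T : D -> Prop) (F : fieldType) (rho : D -> F) : Prop :=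
  ClusterMap {
  cluster_iso : forall x y, isomorphic x y -> rho x = rho y;
  cluster_sum : forall x y z, biproduct x y z -> rho z = rho x * rho y;
  cluster_exchange : forall m l b b' : D,
    indecomposable m -> indecomposable l -> has_dim (hom m (susp D l)) 1 ->
    (exists (f : hom m b) (g : hom b l) (h : hom l (susp D m)),
       dist f g h /\ h <> 0) ->
    (exists (f : hom l b') (g : hom b' m) (h : hom m (susp D l)),
       dist f g h /\ h <> 0) ->
    rho m * rho l = rho b + rho b';
  cluster_basis : exists T' : D -> Prop,
    [/\ cluster_tilting T', reachable T T'
      & transcendence_basis
          (fun w : F => exists t, [/\ T' t, indecomposable t & w = rho t])]
}.

End TriangulatedCategories.

Definition zarc : Type := {a : int * int | a.1 <= a.2 - 2}.
HB.instance Definition _ := Choice.on zarc.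

(* The arrows (m, n) -> (m, n + 1) and (m, n) -> (m + 1, n) of Z A_oo. *)
Definition arc_arrow (a b : zarc) : bool :=
  (val b == ((val a).1, (val a).2 + 1)) || (val b == ((val a).1 + 1, (val a).2)).

(* X identifies the Auslander-Reiten quiver of D with Z A_oo. *)
Record ar_coordinates (k : fieldType) (D : tricat k) (X : zarc -> D) : Prop :=
  ArCoordinates {
  ar_indec : forall a, indecomposable (X a);
  ar_inj : forall a b, isomorphic (X a) (X b) -> a = b;
  ar_surj : forall x, indecomposable x -> exists a, isomorphic (X a) x;
  ar_arrows : forall a b, irr_dim (X a) (X b) (arc_arrow a b);
  ar_susp : forall a b, val b = ((val a).1 - 1, (val a).2 - 1) ->
    isomorphic (susp D (X a)) (X b)
}.

(* The arcs (m, n) with m <= n - 2 and (n, p) with p >= n + 2. *)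
Definition fan (n : int) : pred zarc :=
  fun a => ((val a).2 == n) || ((val a).1 == n).

Definition fan_arc (n : int) : Type := {a : zarc | fan n a}.
HB.instance Definition _ (n : int) := Choice.on (fan_arc n).

(* Main.v *)
(** Specialising all variables to 1 turns rho into a map nu with values in the
positive integers, equal to 1 on the fan, for which the exchange relations
still hold.  Let Y_h be the object on the arc (n - 1 - h, n + 1).  Since
Sigma Y_h lies on (n - 2 - h, n), it belongs to the fan.  The exchange relation
for Y_h and Sigma Y_h comes from the Auslander-Reiten triangle

  Sigma Y_h -> Sigma Y_(h-1) (+) Y_(h+1) -> Y_h

and from Y_h -> 0 -> Sigma Y_h, and it reads nu(Y_h) = nu(Y_(h+1)) + 1.  So
nu(Y_h) decreases for ever, which is absurd.

The triangles come from the 2-spherical object s on (n - 1, n + 1).  A five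
lemma argument along the thick subcategory generated by s shows that
Hom(s, x) x Hom(x, Sigma^2 s) -> Hom(s, Sigma^2 s) is a perfect pairing for all
x.  Starting from Y_0 = s one builds Sigma Y_h -> Y_(h+1) -> s with connecting
morphism s -> Sigma^2 Y_h lifting a generator of Hom(s, Sigma^2 s).  The
octahedral axiom gives the middle term of the Auslander-Reiten triangle, and
comparing irreducible morphisms identifies Y_(h+1) in the coordinates. *)
Require Import Defs.
From HB Require Import structures.
From mathcomp Require Import all_boot all_order all_algebra finmap.
From mathcomp.multinomials Require Import monalg.
From mathcomp Require Import zify.
From Stdlib Require Import Classical ClassicalEpsilon.
(* vector.v, loaded by all_algebra, has another [hom]. *)
Import Defs.

Set Implicit Arguments.
Unset Strict Implicit.
Unset Printing Implicit Defensive.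

Import Order.TTheory GRing.Theory Num.Theory.
Local Open Scope ring_scope.
Local Open Scope cat_scope.

(** * Finite-dimensional spaces and linear forms *)

Section LinearAlgebra.
Variable k : fieldType.

Definition lin_map (V W : lmodType k) (L : V -> W) : Prop :=
  forall a u v, L (a *: u + v) = a *: L u + L v.

Definition lin_form (V : lmodType k) (phi : V -> k) : Prop :=
  forall a u v, phi (a *: u + v) = a * phi u + phi v.

Definition finite_dim (V : lmodType k) : Prop := exists d, has_dim V d.

Definition spanned (V : lmodType k) (n : nat) : Prop :=
  exists e : 'I_n -> V, forall v, exists c : 'rV[k]_n, v = \sum_i c 0 i *: e i.

Lemma lin_map0 (V W : lmodType k) (L : V -> W) : lin_map L -> L 0 = 0.
Proof.
by move=> linL; have := linL (-1) 0 0; rewrite scaler0 add0r scaleN1r addNr.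
Qed.

Lemma lin_mapB (V W : lmodType k) (L : V -> W) u v :
  lin_map L -> L (u - v) = L u - L v.
Proof. by move=> linL; rewrite addrC -scaleN1r linL scaleN1r addrC. Qed.

Lemma lin_map_sum (V W : lmodType k) (L : V -> W) n (c : 'rV[k]_n) e :
  lin_map L -> L (\sum_i c 0 i *: e i) = \sum_i c 0 i *: L (e i).
Proof.
move=> linL; apply: (big_ind2 (fun x y => L x = y)) => [|x1 x2 y1 y2 <- <-|i _].
- exact: lin_map0.
- by rewrite -[x1]scale1r linL !scale1r.
- by rewrite -[_ *: e i]addr0 linL lin_map0 // addr0.
Qed.

Lemma lin_form_map (V : lmodType k) (phi : V -> k) :
  lin_form phi -> lin_map (phi : V -> k^o).
Proof. by []. Qed.

Lemma ex_max_nat (P : nat -> Prop) n b :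
  P n -> (forall m, P m -> (m <= b)%N) ->
  exists2 m, P m & forall l, P l -> (l <= m)%N.
Proof.
move=> + leb; have [d] := ubnP (b - n)%N; elim: d n => // d IHd n ltd Pn.
case: (classic (exists2 m, P m & (n < m)%N)) => [[m Pm lt_nm]|no].
  apply: (IHd m) => //; have := leb _ Pm; rewrite ltnS in ltd.
  move=> le_mb; apply: leq_trans ltd; rewrite ltn_sub2l //; exact: leq_trans le_mb.
exists n => // l Pl; rewrite leqNgt; apply/negP => lt_nl; apply: no.
by exists l.
Qed.

Lemma has_dim_coord (V : lmodType k) d : has_dim V d ->
  exists (e : 'I_d -> V) (kappa : V -> 'rV[k]_d),
    lin_map kappa /\ forall v, v = \sum_i kappa v 0 i *: e i.
Proof.
case=> e He; pose kappa v := sval (constructive_indefinite_description _ (He v)).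
have E v : v = \sum_i kappa v 0 i *: e i.
  by rewrite /kappa; case: constructive_indefinite_description => c [].
have U v (c : 'rV[k]_d) : v = \sum_i c 0 i *: e i -> kappa v = c.
  rewrite /kappa; case: constructive_indefinite_description => c' /= [_ u] /u; exact.
exists e, kappa; split=> // a u v; apply: U.
rewrite {1}(E u) {1}(E v) scaler_sumr -big_split; apply: eq_bigr => i _ /=.
by rewrite !mxE scalerDl scalerA.
Qed.

(** As long as the generators satisfy a nontrivial relation, one of them can be discarded. *)
Lemma spanned_finite_dim (V : lmodType k) n : spanned V n -> finite_dim V.
Proof.
elim: n => [|n IHn] [e He].
  exists 0%N, e => v; have [c ->] := He v; exists c; split=> // c' _.
  by apply/rowP => -[].
case: (classic (exists2 c : 'rV[k]_n.+1, c != 0 & \sum_i c 0 i *: e i = 0)); last first.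
  move=> free; exists n.+1, e => v; have [c ->] := He v; exists c; split=> // c' E.
  apply/eqP; rewrite -subr_eq0; apply/negPn/negP => ne; apply: free.
  exists (c - c') => //; rewrite (eq_bigr (fun i => c 0 i *: e i - c' 0 i *: e i)).
    by rewrite sumrB E subrr.
  by move=> i _; rewrite !mxE scalerBl.
case=> c /rV0Pn [j cj] c0; apply: IHn; exists (fun i => e (lift j i)) => v.
(* Subtracting [a 0 j / c 0 j] times the relation removes the generator [e j]. *)
have [a ->] := He v; exists (\row_i (a 0 (lift j i) - a 0 j / c 0 j * c 0 (lift j i))).
have : \sum_i (a 0 i - a 0 j / c 0 j * c 0 i) *: e i = \sum_i a 0 i *: e i.
  under eq_bigr do rewrite scalerBl -scalerA.
  by rewrite sumrB -scaler_sumr c0 scaler0 subr0.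
move=> <-; rewrite (bigD1_ord j) //= divfK // subrr scale0r add0r.
by apply: eq_bigr => i _; rewrite !mxE.
Qed.

(* Take the [v i] such that the [L (v i)] have maximal rank. *)
Lemma image_spanned (V W : lmodType k) (L : V -> W) d :
  lin_map L -> has_dim W d ->
  exists r (v : 'I_r -> V) (c : W -> 'rV[k]_r),
    lin_map c /\ forall u, L u = L (\sum_i c (L u) 0 i *: v i).
Proof.
move=> linL /has_dim_coord [e [kappa [linK K]]].
pose M r (v : 'I_r -> V) : 'M[k]_(r, d) := \matrix_i kappa (L (v i)).
pose P m := exists r (v : 'I_r -> V), \rank (M r v) = m.
have [m [r [v rk]] maxm] : exists2 m, P m & forall l, P l -> (l <= m)%N.
  apply: (@ex_max_nat P _ d).
    by exists 0%N, (fun _ => 0).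
  by move=> _ [r [v <-]]; exact: rank_leq_col.
(* Adjoining the row of [u] cannot raise the maximal rank, so it already lies in the row space. *)
have sub u : (kappa (L u) <= M r v)%MS.
  pose v' (i : 'I_(1 + r)) := if split i is inr j then v j else u.
  have E : M _ v' = col_mx (kappa (L u)) (M r v).
    apply/row_matrixP => i; rewrite rowK /v' -[in RHS](splitK i).
    case: split => j /=; first by rewrite rowKu; apply/rowP => l; rewrite !mxE (ord1 j).
    by rewrite rowKd rowK.
  have := maxm _ (ex_intro _ _ (ex_intro _ v' erefl)); rewrite E -addsmxE -rk => le.
  rewrite (geq_leqif (mxrank_leqif_sup (addsmxSr _ _))) in le.
  exact: submx_trans (addsmxSl _ _) le.
(* The pseudo-inverse gives coordinates that are linear on all of [W], also outside the image of
   [L]. *)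
exists r, v, (fun w => kappa w *m pinvmx (M r v)); split.
  by move=> a x y; rewrite linK mulmxDl -scalemxAl.
move=> u; have := mulmxKpV (sub u); set c := _ *m pinvmx _ => E.
rewrite lin_map_sum // [LHS]K -E.
transitivity (\sum_i c 0 i *: (\sum_j kappa (L (v i)) 0 j *: e j)); last first.
  by apply: eq_bigr => i _; rewrite -K.
under [RHS]eq_bigr do rewrite scaler_sumr.
rewrite exchange_big; apply: eq_bigr => j _; rewrite mxE scaler_suml.
by apply: eq_bigr => i _; rewrite scalerA !mxE.
Qed.

(** A form vanishing on the kernel of [L] descends to the image; the coordinates of [image_spanned]
    extend it linearly to [W]. *)
Lemma lin_form_factor (V W : lmodType k) (L : V -> W) (phi : V -> k) :
  lin_map L -> finite_dim W -> lin_form phi ->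
  (forall v, L v = 0 -> phi v = 0) ->
  exists2 psi : W -> k, lin_form psi & forall v, psi (L v) = phi v.
Proof.
move=> linL [d dimW] linphi ker.
have [r [v [c [linc Lc]]]] := image_spanned linL dimW.
exists (fun w => \sum_i c w 0 i * phi (v i)).
  move=> a x y; rewrite linc mulr_sumr -big_split; apply: eq_bigr => i _ /=.
  by rewrite !mxE mulrDl mulrA.
move=> u; have /ker : L (u - \sum_i c (L u) 0 i *: v i) = 0.
  by rewrite lin_mapB // -Lc subrr.
rewrite (lin_mapB _ _ (lin_form_map linphi)) => /eqP; rewrite subr_eq0 => /eqP ->.
by rewrite (lin_map_sum _ _ (lin_form_map linphi)).
Qed.

(** The images of a basis of [U] together with the vectors [v i] of [image_spanned] generate [V]. *)
Lemma finite_dim_exact (U V W : lmodType k) (K : U -> V) (L : V -> W) :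
  lin_map K -> lin_map L -> (forall v, L v = 0 -> exists u, v = K u) ->
  finite_dim U -> finite_dim W -> finite_dim V.
Proof.
move=> linK linL ex [m [e He]] [d dimW].
have [r [v [c [linc Lc]]]] := image_spanned linL dimW.
apply: (@spanned_finite_dim _ (m + r)).
exists (fun i => match split i with inl j => K (e j) | inr j => v j end) => x.
have [|u Eu] := ex (x - \sum_i c (L x) 0 i *: v i).
  by rewrite lin_mapB // -Lc subrr.
have [b [Eb _]] := He u; move: (c (L x)) Eu => cx Eu.
exists (row_mx b cx); rewrite big_split_ord /=.
have -> : x = K u + \sum_i cx 0 i *: v i by rewrite -Eu subrK.
rewrite Eb (lin_map_sum _ _ linK); congr (_ + _); apply: eq_bigr => i _.
  by rewrite row_mxEl; case: split_ordP => j // /eqP; rewrite ?eq_lshift ?eq_lrshift // => /eqP ->.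
by rewrite row_mxEr; case: split_ordP => j // /eqP; rewrite ?eq_rshift ?eq_rlshift // => /eqP ->.
Qed.

Lemma finite_dim0 (V : lmodType k) : (forall v : V, v = 0) -> finite_dim V.
Proof. by move=> V0; apply: (@spanned_finite_dim _ 0); exists (fun _ => 0) => v; exists 0; rewrite big_ord0. Qed.

Lemma finite_dim1 (V : lmodType k) (w : V) :
  (forall v : V, exists c, v = c *: w) -> finite_dim V.
Proof.
move=> Vw; apply: (@spanned_finite_dim _ 1); exists (fun _ => w) => v.
by have [c ->] := Vw v; exists (const_mx c); rewrite big_ord1 mxE.
Qed.

Lemma has_dim0 (V : lmodType k) : has_dim V 0 -> forall v : V, v = 0.
Proof. by case=> e He v; have [c [-> _]] := He v; rewrite big_ord0. Qed.

Lemma has_dim1 (V : lmodType k) : has_dim V 1 <->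
  exists2 w : V, w <> 0 & forall v, exists c, v = c *: w.
Proof.
split=> [[e He]|[w w0 Hw]].
  exists (e 0) => [e0|v].
    have [c [_ U]] := He 0.
    have := U (const_mx 1); rewrite big_ord1 e0 scaler0 => /(_ erefl) c1.
    have := U 0; rewrite big_ord1 e0 scaler0 => /(_ erefl) c0.
    have : (const_mx 1 : 'rV[k]_1) 0 0 = (0 : 'rV[k]_1) 0 0 by rewrite -c1 -c0.
    by rewrite !mxE => /eqP; rewrite oner_eq0.
  by have [c [-> _]] := He v; exists (c 0 0); rewrite big_ord1.
exists (fun _ => w) => v; have [c ->] := Hw v; exists (const_mx c).
split=> [|c']; first by rewrite big_ord1 mxE.
rewrite big_ord1 => E; apply/rowP => i; rewrite (ord1 i) mxE; apply/eqP.
rewrite -subr_eq0; apply/negPn/negP => ne; apply: w0.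
by apply: (scalerI ne); rewrite scaler0 scalerBl E subrr.
Qed.

Lemma line_coord (V W : lmodType k) (w : W) (F : V -> W) :
  w <> 0 -> lin_map F -> (forall v, exists c, F v = c *: w) ->
  exists2 phi : V -> k, lin_form phi & forall v, F v = phi v *: w.
Proof.
move=> w0 linF HF.
pose phi v := sval (constructive_indefinite_description _ (HF v)).
have E v : F v = phi v *: w by rewrite /phi; case: constructive_indefinite_description.
exists phi => // a u v; apply/eqP; rewrite -subr_eq0; apply/negPn/negP => ne.
apply: w0; apply: (scalerI ne); rewrite scaler0 scalerBl -E linF !E.
by rewrite scalerDl scalerA subrr.
Qed.

End LinearAlgebra.

(** * Linear and triangulated categories *)

Section LinCat.
Variables (k : fieldType) (C : lincat k).
Implicit Types w x y z : C.

Lemma postcomp_lin x y z (g : hom y z) : lin_map (fun f : hom x y => g ** f).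
Proof. by move=> a u v; rewrite comp_linearr. Qed.

Lemma precomp_lin x y z (f : hom x y) : lin_map (fun g : hom y z => g ** f).
Proof. by move=> a u v; rewrite comp_linearl. Qed.

Lemma comp0l x y z (f : hom x y) : (0 : hom y z) ** f = 0.
Proof. exact: lin_map0 (precomp_lin f). Qed.

Lemma comp0r x y z (g : hom y z) : g ** (0 : hom x y) = 0.
Proof. exact: lin_map0 (postcomp_lin g). Qed.

Lemma compBl x y z (f : hom x y) (g h : hom y z) : (g - h) ** f = g ** f - h ** f.
Proof. exact: lin_mapB (precomp_lin f). Qed.

Lemma compBr x y z (g : hom y z) (f h : hom x y) : g ** (f - h) = g ** f - g ** h.
Proof. exact: lin_mapB (postcomp_lin g). Qed.

Lemma compNl x y z (f : hom x y) (g : hom y z) : (- g) ** f = - (g ** f).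
Proof. by rewrite -sub0r compBl comp0l sub0r. Qed.

Lemma compNr x y z (f : hom x y) (g : hom y z) : g ** (- f) = - (g ** f).
Proof. by rewrite -sub0r compBr comp0r sub0r. Qed.

Lemma compDl x y z (f : hom x y) (g h : hom y z) : (g + h) ** f = g ** f + h ** f.
Proof. by rewrite -{1}[h]opprK compBl compNl opprK. Qed.

Lemma compDr x y z (g : hom y z) (f h : hom x y) : g ** (f + h) = g ** f + g ** h.
Proof. by rewrite -{1}[h]opprK compBr compNr opprK. Qed.

Lemma compZl x y z a (f : hom x y) (g : hom y z) : (a *: g) ** f = a *: (g ** f).
Proof. by rewrite -[a *: g]addr0 comp_linearl comp0l addr0. Qed.

Lemma compZr x y z a (f : hom x y) (g : hom y z) : g ** (a *: f) = a *: (g ** f).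
Proof. by rewrite -[a *: f]addr0 comp_linearr comp0r addr0. Qed.

Lemma iso_id x : is_iso (idm x).
Proof. by exists (idm x); rewrite comp1m. Qed.

Lemma iso_comp x y z (f : hom y z) (g : hom x y) :
  is_iso f -> is_iso g -> is_iso (f ** g).
Proof.
case=> f' [f'f ff'] [g' [g'g gg']]; exists (g' ** f'); split.
  by rewrite -compmA (compmA f') f'f comp1m.
by rewrite -compmA (compmA g) gg' comp1m.
Qed.

Lemma isoN x y (f : hom x y) : is_iso f -> is_iso (- f).
Proof. by case=> g [gf fg]; exists (- g); rewrite !compNl !compNr !opprK. Qed.

Lemma iso_cancelr x y z (f : hom x y) (u v : hom y z) :
  is_iso f -> u ** f = v ** f -> u = v.
Proof. by case=> g [_ fg] /(congr1 (fun a => a ** g)); rewrite -!compmA fg !compm1. Qed.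

Lemma isomorphic_sym x y : isomorphic x y -> isomorphic y x.
Proof. by case=> f [g [gf fg]]; exists g, f. Qed.

Lemma isomorphic_trans x y z : isomorphic x y -> isomorphic y z -> isomorphic x z.
Proof. by case=> f If [g Ig]; exists (g ** f); exact: iso_comp. Qed.

Lemma to_zero x z (f : hom x z) : is_zero z -> f = 0.
Proof. by move=> z0; rewrite -[f]comp1m z0 comp0l. Qed.

Lemma from_zero x z (f : hom z x) : is_zero z -> f = 0.
Proof. by move=> z0; rewrite -[f]compm1 z0 comp0r. Qed.

Lemma iso_zero x y : isomorphic x y -> is_zero x -> is_zero y.
Proof. by case=> f [g [_ fg]] x0; rewrite /is_zero -fg (to_zero g x0) comp0r. Qed.

Lemma biproduct_zerol z x : is_zero z -> biproduct z x x.
Proof.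
move=> z0; exists 0, (idm x), 0, (idm x).
by rewrite !comp1m !comp0l ?compm1 z0 add0r; split.
Qed.

Lemma iso_biproduct x y z : is_zero z -> isomorphic x y -> biproduct x z y.
Proof.
move=> z0 [f [g [gf fg]]]; exists f, 0, g, 0.
by rewrite gf fg !comp0r comp0l z0 addr0; split.
Qed.

(** For nonzero [x] this means End(x) = k; zero objects satisfy it too. *)
Definition scalar_end x := forall f : hom x x, exists a, f = a *: idm x.

Lemma scalar_end_indecomposable x : scalar_end x -> ~ is_zero x -> indecomposable x.
Proof.
move=> Ex x0; split=> // y z [i1 [i2 [p1 [p2 [e1 e2 p1i2 p2i1 e]]]]].
have [a Ea] := Ex (i1 ** p1).
have [a0|a0] := eqVneq a 0.
  left; have p10 : p1 = 0.
    by rewrite -[p1]comp1m -e1 -compmA Ea a0 scale0r comp0r.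
  by rewrite /is_zero -e1 p10 comp0l.
right; have : p2 ** (i1 ** p1) = 0 by rewrite compmA p2i1 comp0l.
rewrite Ea compZr compm1 => h; have p20 : p2 = 0 by apply: (scalerI a0); rewrite h scaler0.
by rewrite /is_zero -e2 p20 comp0l.
Qed.

(** Splitting the complementary idempotent [idm x - e ** r] exhibits [y] as a summand of [x], and
    the other summand must vanish. *)
Lemma split_mono_iso x y (e : hom y x) (r : hom x y) :
  split_idempotents C -> indecomposable x -> ~ is_zero y ->
  r ** e = idm y -> is_iso r.
Proof.
move=> sp [x0 ind] y0 re.
have idem : (idm x - e ** r) ** (idm x - e ** r) = idm x - e ** r.
  rewrite compBl comp1m compBr compm1 compmA -(compmA e) re compm1.
  by rewrite subrr subr0.
have [z [i [p [ip pi]]]] := sp _ _ idem.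
have ri : r ** i = 0.
  rewrite -[i]compm1 -pi (compmA i) ip compBl comp1m compBr -!compmA (compmA r).
  by rewrite re comp1m subrr.
have pe : p ** e = 0.
  rewrite -[p]comp1m -pi -(compmA p) ip compBr compm1 compBl -!compmA re compm1.
  by rewrite subrr.
case: (ind y z).
- by exists e, i, r, p; split=> //; rewrite ip addrC subrK.
- by [].
move=> z0; exists e; split=> //.
by apply/eqP; rewrite eq_sym -subr_eq0 -ip (to_zero p z0) comp0r.
Qed.

(** If [u ** g] were nonzero, it would be an invertible scalar and [u] a split epimorphism out of an
    indecomposable, hence an isomorphism. *)
Lemma non_iso_rad x y (u : hom x y) :
  split_idempotents C -> indecomposable x -> scalar_end y -> ~ is_iso u ->
  forall g : hom y x, u ** g = 0.
Proof.
move=> sp ix Ey nu g; have [a E] := Ey (u ** g).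
have [a0|a0] := eqVneq a 0; first by rewrite E a0 scale0r.
case: (classic (is_zero y)) => [y0|y0]; first exact: to_zero.
case: nu; have : is_iso u.
  apply: (@split_mono_iso x y (a^-1 *: g) u) => //.
  by rewrite compZr E scalerA mulVf // scale1r.
by [].
Qed.

Lemma nilp_iso x (f : hom x x) : f ** f = 0 -> is_iso (idm x - f).
Proof.
move=> ff; exists (idm x + f); split.
  by rewrite compDl comp1m compBr compm1 ff subr0 subrK.
by rewrite compBl comp1m compDr compm1 ff addr0 addrK.
Qed.

Lemma comp0_rad x y (u : hom x y) : (forall g : hom y x, u ** g = 0) -> rad u.
Proof.
by move=> u0 g; apply: nilp_iso; rewrite compmA -(compmA g) u0 comp0r comp0l.
Qed.

Lemma rad_sum_iso x y z (u : hom x y) (v : hom x z) (g : hom y x) (h : hom z x) :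
  rad u -> rad v -> is_iso (idm x - (g ** u + h ** v)).
Proof.
move=> ru rv; have [a [ag ga]] := ru g.
have -> : idm x - (g ** u + h ** v) = (idm x - g ** u) ** (idm x - (a ** h) ** v).
  by rewrite [RHS]compBr compm1 !compmA ga comp1m opprD addrA.
exact: iso_comp.
Qed.

End LinCat.

Section LinFunctor.
Variables (k : fieldType) (C D : lincat k) (F : linfunctor C D).
Implicit Types x y z : C.

Lemma map_lin x y : lin_map (@map_hom _ _ _ F x y).
Proof. by move=> a u v; rewrite map_linear. Qed.

Lemma map0 x y : map_hom F (0 : hom x y) = 0.
Proof. exact: lin_map0 (@map_lin _ _). Qed.

Lemma mapB x y (f g : hom x y) : map_hom F (f - g) = map_hom F f - map_hom F g.
Proof. exact: lin_mapB (@map_lin _ _). Qed.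

Lemma mapN x y (f : hom x y) : map_hom F (- f) = - map_hom F f.
Proof. by rewrite -sub0r mapB map0 sub0r. Qed.

Lemma mapD x y (f g : hom x y) : map_hom F (f + g) = map_hom F f + map_hom F g.
Proof. by rewrite -{1}[g]opprK mapB mapN opprK. Qed.

Lemma mapZ x y a (f : hom x y) : map_hom F (a *: f) = a *: map_hom F f.
Proof. by rewrite -[a *: f]addr0 map_linear map0 addr0. Qed.

Lemma map_iso x y (f : hom x y) : is_iso f -> is_iso (map_hom F f).
Proof. by case=> g [gf fg]; exists (map_hom F g); rewrite -!map_comp gf fg !map_id. Qed.

Lemma map_isomorphic x y : isomorphic x y -> isomorphic (F x) (F y).
Proof. by case=> f If; exists (map_hom F f); exact: map_iso. Qed.

Lemma map_biproduct x y z : biproduct x y z -> biproduct (F x) (F y) (F z).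
Proof.
case=> i1 [i2 [p1 [p2 [e1 e2 p1i2 p2i1 e]]]].
exists (map_hom F i1), (map_hom F i2), (map_hom F p1), (map_hom F p2).
by rewrite -!map_comp e1 e2 p1i2 p2i1 -mapD e !map_id !map0.
Qed.

End LinFunctor.

(** * Exactness, shifts and splitting of triangles *)

Section Triangulated.
Variables (k : fieldType) (D : tricat k).
Implicit Types w x y z : D.
Local Notation S := (susp D).
Local Notation "S1[ f ]" := (map_hom (susp D) f) (at level 0, f at level 99).

Lemma susp_surj x y (g : hom (S x) (S y)) : exists f : hom x y, g = S1[f].
Proof.
have [full _ _] := susp_equivalence D.
by have [f <-] := full _ _ g; exists f.
Qed.

Lemma susp_inj x y (f g : hom x y) : S1[f] = S1[g] -> f = g.
Proof. by have [_ faithful _] := susp_equivalence D; exact: faithful. Qed.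

Lemma susp_inj0 x y (f : hom x y) : S1[f] = 0 -> f = 0.
Proof. by rewrite -(map0 (susp D)); exact: susp_inj. Qed.

Lemma susp_ess y : exists x, isomorphic (S x) y.
Proof. by have [_ _ ess] := susp_equivalence D; exact: ess. Qed.

Lemma susp_biproduct x y z : biproduct (S x) (S y) (S z) -> biproduct x y z.
Proof.
case=> i1 [i2 [p1 [p2 []]]].
have [j1 ->] := susp_surj i1; have [j2 ->] := susp_surj i2.
have [q1 ->] := susp_surj p1; have [q2 ->] := susp_surj p2.
rewrite -!map_comp -mapD -!map_id.
move=> /susp_inj e1 /susp_inj e2 /susp_inj0 e3 /susp_inj0 e4 /susp_inj e5.
by exists j1, j2, q1, q2.
Qed.

Lemma zero_susp z : is_zero z -> is_zero (S z).
Proof. by move=> z0; rewrite /is_zero -map_id z0 map0. Qed.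

Section Exactness.
Variables (x y z : D) (f : hom x y) (g : hom y z) (h : hom z (S x)).
Hypothesis T : dist f g h.

Lemma dist_comp0 : g ** f = 0.
Proof.
have [z0 Z] := (tri_additive D).1.
have E : f ** idm x = f ** idm x by [].
have [c [Ec _]] := dist_morphism (dist_id x Z) T E.
by rewrite -Ec comp0r.
Qed.

(** Completes [a] to a morphism of triangles into [0 -> w -> w]. *)
Lemma dist_factor_r w (a : hom y w) : a ** f = 0 -> exists b, a = b ** g.
Proof.
move=> af; have [z0 Z] := (tri_additive D).1.
have T' : dist (0 : hom z0 w) (idm w) (0 : hom w (S z0)).
  apply/dist_rotate; rewrite map0 oppr0; exact: dist_id (zero_susp Z).
have E : a ** f = (0 : hom z0 w) ** (0 : hom x z0) by rewrite comp0r.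
have [c [Ec _]] := dist_morphism T T' E.
by exists c; rewrite Ec comp1m.
Qed.

Lemma dist_factor_l w (a : hom w y) : g ** a = 0 -> exists b, a = f ** b.
Proof.
move=> ga; have [z0 Z] := (tri_additive D).1.
have T' : dist (0 : hom w z0) (0 : hom z0 (S w)) (- S1[idm w]).
  by apply/(dist_rotate (idm w) 0 0); exact: dist_id.
have E : (0 : hom z0 z) ** (0 : hom w z0) = g ** a by rewrite ga comp0r.
have /dist_rotate T1 := T.
have [c [_ Ec]] := dist_morphism T' T1 E.
have [b Eb] := susp_surj c; exists b; apply: susp_inj.
move: Ec; rewrite map_id compNr compm1 compNl => /oppr_inj ->.
by rewrite Eb map_comp.
Qed.

End Exactness.

(** Three rotations put a sign on all three morphisms; minus the identity on the middle term absorbs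
    the first two. *)
Lemma dist_susp x y z (f : hom x y) (g : hom y z) (h : hom z (S x)) :
  dist f g h -> dist S1[f] S1[g] (- S1[h]).
Proof.
move=> /dist_rotate/dist_rotate/dist_rotate T.
apply: (dist_iso (iso_id _) (isoN (iso_id _)) (iso_id _) _ _ _ T).
- by rewrite compm1 compNl comp1m opprK.
- by rewrite comp1m compNr compm1.
- by rewrite map_id comp1m compm1.
Qed.

(** The cone of [h] is isomorphic to a shift [S e]; the signs of [i] and [g] are chosen to cancel
    those of the two rotations. *)
Lemma cocone y z (h : hom y (S z)) : exists e (i : hom z e) (g : hom e y), dist i g h.
Proof.
have [w [u [v T]]] := dist_cone h.
have [e [phi Iphi]] := susp_ess w; have [psi [pp qq]] := Iphi.
have [i Ei] := susp_surj (- (psi ** u)); have [g Eg] := susp_surj (- (v ** phi)).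
exists e, i, g; apply/dist_rotate/dist_rotate; rewrite -Ei -Eg !opprK.
have Ipsi : is_iso psi by exists phi.
apply: (dist_iso (iso_id _) (iso_id _) Ipsi _ _ _ T).
- by rewrite comp1m compm1.
- by rewrite compm1.
- by rewrite map_id comp1m -compmA qq compm1.
Qed.

(** The vanishing connecting morphism gives [g] a section and makes [f] a monomorphism. *)
Lemma split_triangle x y z (f : hom x y) (g : hom y z) :
  dist f g (0 : hom z (S x)) -> biproduct x z y.
Proof.
move=> T; have [s Es] : exists s, idm z = g ** s.
  have /dist_rotate T1 := T.
  by apply: (dist_factor_l T1); rewrite comp0l.
have gf := dist_comp0 T.
have [r Er] : exists r, idm y - s ** g = f ** r.
  by apply: (dist_factor_l T); rewrite compBr compm1 compmA -Es comp1m subrr.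
have finj w (a : hom w x) : f ** a = 0 -> a = 0.
  move=> fa; apply: susp_inj0; have /dist_rotate/dist_rotate T2 := T.
  have /(dist_factor_l T2) [b ->] : (- S1[f]) ** S1[a] = 0.
    by rewrite compNl -map_comp fa map0 oppr0.
  by rewrite comp0l.
exists f, s, r, g; split=> //.
- apply/eqP; rewrite -subr_eq0; apply/eqP/finj.
  by rewrite compBr compm1 compmA -Er compBl comp1m -compmA gf comp0r subr0 subrr.
- by apply: finj; rewrite compmA -Er compBl comp1m -compmA -Es compm1 subrr.
- by rewrite -Er subrK.
Qed.

End Triangulated.

(** * Serre duality for a spherical object *)

Section Pairing.
Variables (k : fieldType) (D : tricat k).
Implicit Types e w x y z : D.
Local Notation S := (susp D).
Local Notation "S1[ f ]" := (map_hom (susp D) f) (at level 0, f at level 99).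

Definition spans_hom x y (w : hom x y) : Prop :=
  w <> 0 /\ forall f : hom x y, exists a, f = a *: w.

Lemma spans_susp x y (w : hom x y) : spans_hom w -> spans_hom S1[w].
Proof.
case=> w0 sp; split=> [/susp_inj0//|f].
have [g ->] := susp_surj f; have [a ->] := sp g.
by exists a; rewrite mapZ.
Qed.

(* The pairing (f, g) |-> f ** g of hom x (S (S e)) and hom e x, with values in
   the line spanned by om, is perfect. *)
Definition perfect e (om : hom e (S (S e))) x : Prop :=
  [/\ forall f : hom x (S (S e)), (forall g : hom e x, f ** g = 0) -> f = 0,
      forall phi : hom e x -> k, lin_form phi ->
        exists f : hom x (S (S e)), forall g, f ** g = phi g *: om
    & finite_dim (hom e x)].

Lemma perfect_cone e (om : hom e (S (S e))) x y z
    (u : hom x y) (v : hom y z) (w : hom z (S x)) :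
  spans_hom om -> dist u v w ->
  perfect om x -> perfect om y -> perfect om (S x) -> perfect om (S y) ->
  perfect om z.
Proof.
move=> [om0 sp] T [Ix _ _] [Iy Sy fdy] [ISx SSx fdSx] [_ SSy fdSy].
have /dist_rotate T1 := T; have /dist_rotate T2 := T1.
have wl (g : hom e z) : w ** g = 0 -> exists g', g = v ** g' by apply: dist_factor_l T1 _ _.
split.
- move=> f f0; have fv : f ** v = 0 by apply: Iy => g; rewrite -compmA f0.
  have [f' Ef] := dist_factor_r T1 fv.
  have [phi linphi Ephi] := line_coord om0 (postcomp_lin f') (fun g => sp (f' ** g)).
  (* The form of [f'] factors through composition with [S1[u]]. Hence [f'] itself factors through
     [S1[u]], and [f = f' ** w] vanishes. *)
  have [|psi linpsi Epsi] := lin_form_factor (postcomp_lin S1[u]) fdSy linphi.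
    move=> g ug; have [|g' Eg] := dist_factor_l T2 (a := g).
      by rewrite compNl ug oppr0.
    have := Ephi g; rewrite Eg compmA -Ef f0 => E; apply/eqP/negPn/negP => ne.
    by apply: om0; apply: (scalerI ne); rewrite -E scaler0.
  have [f'' Ef''] := SSy _ linpsi.
  have Ef' : f'' ** S1[u] - f' = 0.
    by apply: ISx => g; rewrite compBl -compmA Ef'' Epsi Ephi subrr.
  move/eqP: Ef'; rewrite subr_eq0 => /eqP Ef'.
  have := dist_comp0 T2; rewrite compNl => /eqP; rewrite oppr_eq0 => /eqP uw.
  by rewrite Ef -Ef' -compmA uw comp0r.
- move=> phi linphi.
  have [|fy Efy] := Sy (fun g => phi (v ** g)).
    by move=> a g g'; rewrite comp_linearr linphi.
  have fyu : fy ** u = 0.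
    apply: Ix => g; rewrite -compmA Efy compmA (dist_comp0 T) comp0l.
    by rewrite (lin_map0 (lin_form_map linphi)) scale0r.
  have [f1 Ef1] := dist_factor_r T fyu.
  (* [F] is the error of [f1] as a representative of [phi]; it vanishes on composites with [v], so a
     morphism through [w] corrects it. *)
  pose F (g : hom e z) := phi g *: om - f1 ** g.
  have linF : lin_map F.
    move=> a g g'; rewrite /F linphi comp_linearr scalerDl scalerBr scalerA.
    by rewrite opprD addrACA.
  have [phi2 lin2 E2] := line_coord om0 linF (fun g => sp (F g)).
  have [|psi linpsi Epsi] := lin_form_factor (postcomp_lin w) fdSx lin2.
    move=> g /wl [g' Eg]; have := E2 g.
    rewrite /F Eg compmA -Ef1 Efy subrr => E; apply/eqP/negPn/negP => ne.
    by apply: om0; apply: (scalerI ne); rewrite -E scaler0.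
  have [f2 Ef2] := SSx _ linpsi.
  exists (f1 + f2 ** w) => g; rewrite compDl -compmA Ef2 Epsi -E2 /F.
  by rewrite addrC subrK.
- exact: finite_dim_exact (postcomp_lin v) (postcomp_lin w) wl fdy fdSx.
Qed.

Lemma perfect_summand e (om : hom e (S (S e))) x y z :
  biproduct x y z -> perfect om z -> perfect om x.
Proof.
case=> i1 [_] [p1] [_] [p1i1 _ _ _ _] [Iz Sz fdz]; split.
- move=> f f0; rewrite -[f]compm1 -p1i1 compmA (Iz (f ** p1)) ?comp0l // => g.
  by rewrite -compmA f0.
- move=> phi linphi; have [|F EF] := Sz (fun g => phi (p1 ** g)).
    by move=> a g g'; rewrite comp_linearr linphi.
  by exists (F ** i1) => g; rewrite -compmA EF compmA p1i1 comp1m.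
- have [d [b Hb]] := fdz; apply: (@spanned_finite_dim _ _ d).
  exists (fun j => p1 ** b j) => g; have [c [Ec _]] := Hb (i1 ** g); exists c.
  rewrite -(lin_map_sum _ _ (postcomp_lin p1)) /=.
  by rewrite -Ec compmA p1i1 comp1m.
Qed.

Lemma perfect_susp e (om : hom e (S (S e))) x :
  perfect om x <-> perfect S1[om] (S x).
Proof.
split=> -[I' S' [d [b Hb]]]; split.
- move=> f f0; have [f' Ef] := susp_surj f; rewrite Ef (I' f') ?map0 // => g.
  by apply: susp_inj0; rewrite map_comp -Ef f0.
- move=> phi linphi; have [|f Ef] := S' (fun g => phi S1[g]).
    by move=> a g g'; rewrite map_linear linphi.
  exists S1[f] => g; have [g' ->] := susp_surj g.
  by rewrite -map_comp Ef mapZ.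
- apply: (@spanned_finite_dim _ _ d); exists (fun j => S1[b j]) => g.
  have [g' ->] := susp_surj g; have [c [-> _]] := Hb g'; exists c.
  exact: (lin_map_sum c b (@map_lin _ _ _ S e x)).
- move=> f f0; apply: susp_inj0; apply: I' => g; have [g' ->] := susp_surj g.
  by rewrite -map_comp f0 map0.
- move=> phi linphi.
  pose inv (g : hom (S e) (S x)) := sval (constructive_indefinite_description _ (susp_surj g)).
  have invE g : g = S1[inv g] by rewrite /inv; case: constructive_indefinite_description.
  have invK g : inv S1[g] = g by apply: susp_inj; rewrite -invE.
  have [|f Ef] := S' (fun g => phi (inv g)).
    by move=> a g g'; rewrite -linphi {1}(invE g) {1}(invE g') -map_linear invK.
  have [f' Ef'] := susp_surj f; exists f' => g; apply: susp_inj.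
  by rewrite map_comp -Ef' Ef invK mapZ.
- apply: (@spanned_finite_dim _ _ d).
  pose inv (g : hom (S e) (S x)) := sval (constructive_indefinite_description _ (susp_surj g)).
  have invE g : g = S1[inv g] by rewrite /inv; case: constructive_indefinite_description.
  exists (fun j => inv (b j)) => g; have [c [Ec _]] := Hb S1[g]; exists c.
  apply: susp_inj; rewrite Ec; etransitivity; last first.
    by symmetry; exact: (lin_map_sum c _ (@map_lin _ _ _ S e x)).
  by apply: eq_bigr => j _; rewrite -invE.
Qed.

Fixpoint iter_form s (om : hom s (S (S s))) n : hom (iter n S s) (S (S (iter n S s))) :=
  if n is n'.+1 then S1[iter_form om n'] else om.

Lemma iter_form_spans s (om : hom s (S (S s))) n : spans_hom om -> spans_hom (iter_form om n).
Proof. by move=> sp; elim: n => //= n; exact: spans_susp. Qed.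

Lemma iter_dist n x y z (f : hom x y) (g : hom y z) (h : hom z (S x)) :
  dist f g h -> exists (f' : hom (iter n S x) (iter n S y)) (g' : hom _ (iter n S z)) h',
  dist f' g' h'.
Proof.
move=> T; elim: n => [|n [f' [g' [h' T']]]]; first by exists f, g, h.
by exists S1[f'], S1[g'], (- S1[h']); exact: dist_susp.
Qed.

Lemma iter_biproduct n x y z :
  biproduct x y z -> biproduct (iter n S x) (iter n S y) (iter n S z).
Proof. by move=> B; elim: n => //= n; exact: map_biproduct. Qed.

(** Shifting form and object independently makes the property invariant under the shift in both
    directions, as [thick] requires. *)
Lemma perfect_thick s (om : hom s (S (S s))) : spans_hom om ->
  thick (fun x => forall a b, perfect (iter_form om a) (iter b S x)).
Proof.
move=> sp; split.
- move=> x y iso_xy P a b; have [z z0] := (tri_additive D).1.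
  by apply: perfect_summand (P a b); apply/iter_biproduct/(iso_biproduct z0)/isomorphic_sym.
- move=> x; split=> P a b; first by rewrite -iterSr.
  by apply/perfect_susp; have := P a.+1 b; rewrite -iterSr.
- move=> x y z f g h T Px Py a b; have [f' [g' [h' T']]] := iter_dist b T.
  by apply: perfect_cone T' (Px a b) (Py a b) (Px a b.+1) (Py a b.+1); exact: iter_form_spans.
- move=> x y z B P a b; apply: perfect_summand (P a b); exact: iter_biproduct B.
Qed.

(** The consequences of being a 2-spherical generator on which the tower rests; the last clause is
    Serre duality for [s]. *)
Definition sphere s (om : hom s (S (S s))) : Prop :=
  [/\ spans_hom om, spans_hom (idm s), forall f : hom s (S s), f = 0,
      forall n (f : hom s (iter n.+3 S s)), f = 0
    & forall x, perfect om x].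

(** By [perfect_thick] it suffices to treat shifts of [s]. There the Hom spaces vanish outside
    degrees 0 and 2, where the pairing is composition with an identity. *)
Lemma sphereP s : spherical2 s -> classical_generator s -> exists om, @sphere s om.
Proof.
move=> sph gen.
have hom0 n : n != 0%N -> n != 2%N -> forall f : hom s (iter n S s), f = 0.
  move=> n0 n2; have := sph (Posz n); rewrite /= !eqz_nat (negbTE n0) (negbTE n2).
  exact: has_dim0.
have hom0' n : forall f : hom (iter n.+1 S s) s, f = 0.
  by have := sph (Negz n); exact: has_dim0.
have sp1 : spans_hom (idm s).
  have /has_dim1 [w w0 Hw] := sph 0; have [a E] := Hw (idm s).
  have a0 : a != 0.
    by apply/eqP => a0; apply: w0; rewrite -[w]comp1m E a0 scale0r comp0l.
  split=> [id0|f]; first by apply: w0; rewrite -[w]comp1m id0 comp0l.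
  have [c ->] := Hw f; exists (c / a); by rewrite E scalerA divfK.
have /has_dim1 [om om0 Hom] : has_dim (hom s (S (S s))) 1 := sph 2%N.
have spom : spans_hom om by [].
have zero e (o : hom e (S (S e))) x : (forall f : hom e x, f = 0) ->
    (forall f : hom x (S (S e)), f = 0) -> perfect o x.
  move=> z1 z2; split=> [f _|phi linphi|]; [exact: z2| |exact: finite_dim0].
  exists 0 => g; rewrite comp0l (z1 g).
  by rewrite (lin_map0 (lin_form_map linphi)) scale0r.
have one e (o : hom e (S (S e))) x (g0 : hom e x) (f0 : hom x (S (S e))) :
    spans_hom o -> spans_hom g0 -> spans_hom f0 -> f0 ** g0 = o -> perfect o x.
  move=> [o0 spo] [g00 spg] [f00 spf] E; split.
  - move=> f /(_ g0); have [a ->] := spf f; rewrite compZl E => H.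
    have [->|a0] := eqVneq a 0; first by rewrite scale0r.
    by case: o0; apply: (scalerI a0); rewrite H scaler0.
  - move=> phi linphi; exists (phi g0 *: f0) => g; have [a ->] := spg g.
    rewrite compZl compZr E scalerA.
    have := linphi a g0 0; rewrite !addr0 (lin_map0 (lin_form_map linphi)) addr0 => ->.
    by rewrite mulrC.
  - exact: finite_dim1 spg.
have base0 n : perfect om (iter n S s).
  case: n => [|[|[|n]]] /=.
  - by apply: (one _ _ _ (idm s) om) => //; rewrite compm1.
  - apply: zero; first exact: (hom0 1%N).
    by move=> f; have [g ->] := susp_surj f; rewrite (hom0 1%N _ _ g) // map0.
  - apply: (one _ _ _ om (idm _)) => //; last by rewrite comp1m.
    by have := spans_susp (spans_susp sp1); rewrite !map_id.
  - apply: zero; first exact: (hom0 n.+3).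
    move=> f; have [g Eg] := susp_surj f; have [h Eh] := susp_surj g.
    by rewrite Eg Eh (hom0' n h) !map0.
have base1 n : perfect (iter_form om n.+1) s.
  apply: zero; first exact: hom0'.
  rewrite -!iterS; exact: hom0.
have base a b : perfect (iter_form om a) (iter b S s).
  elim: a b => [|a IHa] [|b]; [exact: base0|exact: base0|exact: base1|].
  exact: (perfect_susp _ _).1 (IHa b).
exists om; split=> // [||x].
- exact: (hom0 1%N).
- by move=> n; exact: hom0.
- exact: (gen _ (perfect_thick spom) base x 0%N 0%N).
Qed.

End Pairing.

(** * Iterated self-extensions of a spherical object *)

Section Tower.
Variables (k : fieldType) (D : tricat k).
Implicit Types w x y z : D.
Local Notation S := (susp D).
Local Notation "S1[ f ]" := (map_hom (susp D) f) (at level 0, f at level 99).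

(** Half of Serre duality for [y]: the composition pairing, with values in hom y (S (S y)), is
    non-degenerate in [f]. *)
Definition detects y : Prop :=
  forall x (f : hom x (S (S y))), (forall g : hom y x, f ** g = 0) -> f = 0.

Lemma detects_susp y : detects y -> detects (S y).
Proof.
move=> dy x f f0; have [x' [phi Iphi]] := susp_ess x.
have [f' Ef'] := susp_surj (f ** phi).
apply: (iso_cancelr Iphi); rewrite comp0l Ef' (dy _ f') ?map0 // => g.
by apply: susp_inj0; rewrite map_comp -Ef' -compmA f0.
Qed.

Variables (s : D) (om : hom s (S (S s))).
Hypothesis sph : sphere om.

Let detects_s : detects s.
Proof. by case: sph => _ _ _ _ P x; case: (P x). Qed.

(** Induction hypothesis on the objects Y_h with their projections to [s]. By [to_lift] and
    [to_inj], [p] identifies Hom(s, Sigma^2 y) with the line of [om]; by [to_socle], the future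
    connecting morphism [c ** p] is nonzero. *)
Record tower_obj y (p : hom y s) : Prop := TowerObj {
  to_end : scalar_end y;
  to_lift : exists c : hom s (S (S y)), S1[S1[p]] ** c = om;
  to_inj : forall c : hom s (S (S y)), S1[S1[p]] ** c = 0 -> c = 0;
  to_ext1 : forall f : hom s (S y), f = 0;
  to_ext3 : forall n (f : hom s (iter n.+3 S y)), f = 0;
  to_ext2 : forall f : hom y (S (S y)), exists c : hom s (S (S y)), f = c ** p;
  to_detects : detects y;
  to_socle : forall c : hom s (S (S y)), S1[S1[p]] ** c = om -> c ** p <> 0;
  to_rigid : forall f : hom y (S y), f = 0
}.

Section Derived.
Variables (y : D) (p : hom y s).
Hypothesis ty : tower_obj p.

Lemma to_class (c : hom s (S (S y))) :
  S1[S1[p]] ** c = om -> forall c' : hom s (S (S y)), exists a, c' = a *: c.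
Proof.
move=> Ec c'; have [[_ sp] _ _ _ _] := sph.
have [a Ea] := sp (S1[S1[p]] ** c'); exists a.
apply/eqP; rewrite -subr_eq0; apply/eqP/(to_inj ty).
by rewrite compBr compZr Ec Ea subrr.
Qed.

(** Serre duality for [s] determines a map to [s] by its pairing with hom s (S (S y)), a line
    spanned by [c]. The same duality gives the two vanishing results that follow. *)
Lemma to_hom_s (f : hom y s) : exists a, f = a *: p.
Proof.
have [[_ sp] _ _ _ _] := sph; have [c Ec] := to_lift ty.
have [a Ea] := sp (S1[S1[f]] ** c); exists a.
apply/eqP; rewrite -subr_eq0; apply/eqP/susp_inj0/susp_inj0/detects_s => g.
have [b ->] := to_class Ec g.
by rewrite compZr !mapB !mapZ compBl compZl Ec Ea subrr scaler0.
Qed.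

Lemma to_hom_Ss (f : hom y (S s)) : f = 0.
Proof.
by apply/susp_inj0/detects_s => g; rewrite (to_ext1 ty g) comp0r.
Qed.

Lemma to_hom_susp (f : hom (S y) s) : f = 0.
Proof.
by apply/susp_inj0/susp_inj0/detects_s => g; rewrite (to_ext3 ty (n := 0) g) comp0r.
Qed.

End Derived.

Lemma tower_base : tower_obj (idm s).
Proof.
have [[om0 sp] [id0 sp1] s1 s3 P] := sph; split=> //.
- by exists om; rewrite !map_id comp1m.
- by move=> c; rewrite !map_id comp1m.
- by move=> f; exists f; rewrite compm1.
- by move=> c; rewrite !map_id comp1m compm1 => ->.
Qed.

(** * One step up the tower *)

Section Step.
Variables (y y' : D) (p : hom y s) (i : hom (S y) y') (q : hom y' s).
Variable c : hom s (S (S y)).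
Hypotheses (ty : tower_obj p) (Ec : S1[S1[p]] ** c = om) (T : dist i q c).

Let T1 : dist q c (- S1[i]). Proof. exact: (dist_rotate _ _ _).1 T. Qed.
Let T2 : dist c (- S1[i]) (- S1[q]). Proof. exact: (dist_rotate _ _ _).1 T1. Qed.

Let cq : c ** q = 0. Proof. exact: dist_comp0 T1. Qed.
Let ic : S1[i] ** c = 0.
Proof. by have := dist_comp0 T2; rewrite compNl => /eqP; rewrite oppr_eq0 => /eqP. Qed.

Let c0 : c <> 0.
Proof. by move=> c0; have [[om0 _] _ _ _ _] := sph; apply: om0; rewrite -Ec c0 comp0r. Qed.

Let c_inj a : a *: c = 0 -> a = 0.
Proof.
by move=> E; apply/eqP/negPn/negP => ne; apply: c0; apply: (scalerI ne); rewrite E scaler0.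
Qed.

Let factor_i w (f : hom w y') : q ** f = 0 -> exists g, f = i ** g.
Proof. exact: dist_factor_l T _ _. Qed.

Let factor_q w (f : hom y' w) : f ** i = 0 -> exists g, f = g ** q.
Proof. exact: dist_factor_r T _ _. Qed.

Let factor_Si w (f : hom w (S y')) : S1[q] ** f = 0 -> exists g, f = S1[i] ** g.
Proof. exact: dist_factor_l (dist_susp T) _ _. Qed.

Let dist_susp2 : dist S1[S1[i]] S1[S1[q]] S1[S1[c]].
Proof. by have := dist_susp (dist_susp T); rewrite mapN opprK. Qed.

(** Such an [f] comes from hom s (S (S y)), which is spanned by [c], and [S1[i]] kills [c]. *)
Let ext1' (f : hom s (S y')) : f = 0.
Proof.
have [_ _ s1 _ _] := sph; have [g ->] := factor_Si (s1 (S1[q] ** f)).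
by have [a ->] := to_class ty Ec g; rewrite compZr ic scaler0.
Qed.

Let inj' (d : hom s (S (S y'))) : S1[S1[q]] ** d = 0 -> d = 0.
Proof.
move=> /(dist_factor_l dist_susp2) [g ->].
by rewrite (to_ext3 ty (n := 0) g) comp0r.
Qed.

Let lift' : exists d : hom s (S (S y')), S1[S1[q]] ** d = om.
Proof.
have [|d Ed] := dist_factor_l ((dist_rotate _ _ _).1 dist_susp2) (a := om).
  exact: (to_ext3 ty (n := 1)).
by exists d.
Qed.

(** The scalar in [q ** f = a *: p] vanishes because [c ** q = 0] while [c ** p] is nonzero; then
    [f] factors through hom y (S y) = 0. *)
Let hom_step (f : hom y y') : f = 0.
Proof.
have [a Ea] := to_hom_s ty (q ** f).
have a0 : a = 0.
  apply/eqP/negPn/negP => a0; apply: (to_socle ty Ec); apply: (scalerI a0).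
  by rewrite -compZr -Ea compmA cq comp0l scaler0.
have [|g ->] := factor_i (f := f); first by rewrite Ea a0 scale0r.
by rewrite (to_rigid ty g) comp0r.
Qed.

Let hom_susp_step (f : hom y (S y')) : f = 0.
Proof.
have [g ->] := factor_Si (to_hom_Ss ty (S1[q] ** f)).
have [g' ->] := to_ext2 ty g; have [a ->] := to_class ty Ec g'.
by rewrite compZl compZr compmA ic comp0l scaler0.
Qed.

Let hom_Ss' (f : hom y' (S s)) : f = 0.
Proof. by apply/susp_inj0/detects_s => g; rewrite (ext1' g) comp0r. Qed.

Let hom_s' (f : hom y' s) : exists a, f = a *: q.
Proof.
have /factor_q [g ->] := to_hom_susp ty (f ** i).
have [_ [_ sp1] _ _ _] := sph; have [a ->] := sp1 g.
by exists a; rewrite compZl comp1m.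
Qed.

Let rigid' (f : hom y' (S y')) : f = 0.
Proof.
have [g ->] := factor_Si (hom_Ss' (S1[q] ** f)).
have [|g' ->] := factor_q (f := g).
  by have [h ->] := susp_surj (g ** i); rewrite (to_rigid ty h) map0.
have [a ->] := to_class ty Ec g'.
by rewrite compZl compZr compmA ic comp0l scaler0.
Qed.

Let end' : scalar_end y'.
Proof.
move=> f; have [a Ea] := hom_s' (q ** f); exists a.
have [|g Eg] := factor_i (f := f - a *: idm y').
  by rewrite compBr compZr compm1 Ea subrr.
apply/eqP; rewrite -subr_eq0 Eg; apply/eqP.
(* [g ** i] is the shift of a scalar [b], and [S1[i] ** c = 0] gives [b *: c = 0]. *)
have [h Eh] := susp_surj (g ** i); have [b Eb] := to_end ty h.
have b0 : b = 0.
  apply: c_inj; rewrite -[c]comp1m -compZl -!map_id -!mapZ -Eb -Eh map_comp.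
  by rewrite -compmA ic comp0r.
have [|g' ->] := factor_q (f := g); first by rewrite Eh Eb b0 scale0r map0.
by rewrite (to_ext1 ty g') comp0l comp0r.
Qed.

Let ext2' (f : hom y' (S (S y'))) : exists d : hom s (S (S y')), f = d ** q.
Proof.
apply: factor_q; have [h ->] := susp_surj (f ** i).
by rewrite (hom_susp_step h) map0.
Qed.

(** If [d ** q] vanished, [d] would be [c] followed by the double shift of a map from [y] to [y'],
    hence zero. *)
Let socle' (d : hom s (S (S y'))) : S1[S1[q]] ** d = om -> d ** q <> 0.
Proof.
move=> Ed dq; have [z Ez] := dist_factor_r T1 dq.
have [z1 Ez1] := susp_surj z; have [z2 Ez2] := susp_surj z1.
have [[om0 _] _ _ _ _] := sph.
by apply: om0; rewrite -Ed Ez Ez1 Ez2 (hom_step z2) !map0 comp0l comp0r.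
Qed.

Let ext3' n (f : hom s (iter n.+3 S y')) : f = 0.
Proof.
have [_ _ _ s3 _] := sph.
have [i' [q' [c' T']]] := iter_dist n.+3 T.
have [g ->] := dist_factor_l T' (s3 n (q' ** f)).
have -> : g = 0; last by rewrite comp0r.
by move: g; rewrite -iterSr; exact: (to_ext3 ty (n := n.+1)).
Qed.

(* A form on hom (S y) x killed by the maps that extend to y' is induced by
   some theta : x -> S s; subtracting S1[c] ** theta reduces the claim to y. *)
Let detects' : detects y'.
Proof.
have [_ _ _ _ P] := sph.
move=> x f f0.
have qf : S1[S1[q]] ** f = 0.
  apply: detects_s => g; rewrite -compmA.
  have -> : f ** g = 0; last by rewrite comp0r.
  have [|z ->] := dist_factor_r T1 (a := f ** g).
    by rewrite -compmA f0.
  have [z1 ->] := susp_surj z; have [z2 ->] := susp_surj z1.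
  by rewrite (hom_step z2) !map0 comp0l.
have [fa Efa] := dist_factor_l dist_susp2 qf.
(* The lift [fa] still kills all maps from [y']: its ambiguity comes from hom y' (S s), which
   vanishes. *)
have fa0 (g : hom y' x) : fa ** g = 0.
  have [|xi ->] := dist_factor_l (dist_susp T2) (a := fa ** g); last first.
    by rewrite (hom_Ss' xi) comp0r.
  by rewrite mapN compNl compmA -Efa f0 oppr0.
have cp0 : S1[c ** p] <> 0 by move=> /susp_inj0; exact: (to_socle ty Ec).
have [phi linphi Ephi] : exists2 phi : hom (S y) x -> k, lin_form phi &
    forall g, fa ** g = phi g *: S1[c ** p].
  apply: line_coord (postcomp_lin fa) _ => // g.
  have [u ->] := susp_surj (fa ** g); have [d ->] := to_ext2 ty u.
  by have [a ->] := to_class ty Ec d; exists a; rewrite compZl mapZ.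
pose L (g : hom (S y) x) := S1[g] ** c.
have linL : lin_map L by move=> a g g'; rewrite /L map_linear comp_linearl.
have [_ S_Sx fd_Sx] := P (S x).
have [|psi linpsi Epsi] := lin_form_factor linL fd_Sx linphi.
  move=> g Lg; have [G EG] := dist_factor_r T2 Lg.
  have [G' EG'] := susp_surj G.
  have Eg : g = - (G' ** i).
    by apply: susp_inj; rewrite EG EG' compNr mapN map_comp.
  have := Ephi g; rewrite Eg compNr compmA fa0 comp0l oppr0 => E.
  by apply/eqP/negPn/negP => ne; apply: cp0; apply: (scalerI ne); rewrite -E scaler0.
have [theta' Eth'] := S_Sx _ linpsi; have [theta Eth] := susp_surj theta'.
have [[om0 _] _ _ _ _] := sph.
(* Both terms pair equally with hom (S y) x, so they agree by detection for [S y]. *)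
have key : fa - S1[c] ** theta = 0.
  apply: (detects_susp (to_detects ty)) => g.
  have [u Eu] := susp_surj (theta ** g); have [mu Emu] := to_hom_s ty u.
  have Emu' : mu = phi g.
    apply/eqP; rewrite -subr_eq0; apply/negPn/negP => ne; apply: om0.
    apply: (scalerI ne); rewrite scaler0 scalerBl -Epsi -Eth' -Ec -compZl -!mapZ.
    by rewrite -Emu -Eu map_comp -Eth compmA subrr.
  rewrite compBl -compmA Eu Emu Emu' Ephi mapZ compZr map_comp subrr //.
move/eqP: key; rewrite subr_eq0 => /eqP key.
by rewrite Efa key compmA -map_comp ic map0 comp0l.
Qed.

Lemma tower_step : tower_obj q.
Proof. by split. Qed.

End Step.

End Tower.

(** * Auslander-Reiten triangles *)

Lemma has_dim_bij (k : fieldType) (V W : lmodType k) (F : V -> W) d :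
  lin_map F -> (forall v v', F v = F v' -> v = v') -> (forall w, exists v, w = F v) ->
  has_dim V d -> has_dim W d.
Proof.
move=> linF inj surj [e He]; exists (fun i => F (e i)) => w.
have [v ->] := surj w; have [c [Ec U]] := He v; exists c.
by split=> [|c' /eqP]; rewrite -(lin_map_sum _ _ linF); [rewrite {1}Ec|move=> /eqP/inj/U].
Qed.

Lemma irr_dim1 (k : fieldType) (C : lincat k) (x y : C) :
  irr_dim x y 1 -> exists2 b : hom x y, rad b & ~ rad2 b.
Proof.
have rad0 (u v : C) : rad (0 : hom u v).
  by move=> g; rewrite comp0r subr0; exact: iso_id.
case=> b [rb Hb]; exists (b 0) => // r2.
have [c [_ U]] := Hb _ (rb 0).
have E0 : c = 0 by apply: U; rewrite big_ord1 mxE scale0r subr0.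
have E1 : c = const_mx 1.
  apply: U; rewrite big_ord1 mxE scale1r subrr; exists x, 0, 0.
  by rewrite comp0l; split.
have : c 0 0 = c 0 0 by []; rewrite {1}E0 E1 !mxE => /eqP.
by rewrite eq_sym oner_eq0.
Qed.

(** * Invariance of spherical generators under isomorphism and shift *)

Section Spherical.
Variables (k : fieldType) (D : tricat k).
Implicit Types x y z : D.
Local Notation S := (susp D).

Definition spherical_generator x : Prop := spherical2 x /\ classical_generator x.

Lemma hom_iso_dim x x' y y' d : isomorphic x x' -> isomorphic y y' ->
  has_dim (hom x y) d -> has_dim (hom x' y') d.
Proof.
case=> f [f' [f'f ff']] [g [g' [g'g gg']]].
apply: (has_dim_bij (F := fun h => g ** h ** f')).
- by move=> a u v; rewrite comp_linearr comp_linearl.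
- move=> u v /(congr1 (fun h => g' ** h ** f)).
  by rewrite !compmA g'g !comp1m -!compmA f'f !compm1.
- by move=> w; exists (g' ** w ** f); rewrite !compmA gg' comp1m -!compmA ff' compm1.
Qed.

Lemma iter_isomorphic n x y : isomorphic x y -> isomorphic (iter n S x) (iter n S y).
Proof. by move=> I; elim: n => //= n; exact: map_isomorphic. Qed.

Lemma spherical_generator_iso x y :
  isomorphic x y -> spherical_generator x -> spherical_generator y.
Proof.
move=> I [sph gen]; split=> [i|P thP Py].
  have := sph i; case: i => n; apply: hom_iso_dim => //; exact: iter_isomorphic.
by apply: gen => //; case: thP => + _ _ _; apply; last exact: Py; exact: isomorphic_sym.
Qed.

Lemma hom_susp_dim x y d : has_dim (hom x y) d <-> has_dim (hom (S x) (S y)) d.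
Proof.
split.
- apply: has_dim_bij (@map_lin _ _ _ S x y) _ _; [exact: susp_inj|exact: susp_surj].
- pose inv (g : hom (S x) (S y)) := sval (constructive_indefinite_description _ (susp_surj g)).
  have invE g : g = map_hom S (inv g) by rewrite /inv; case: constructive_indefinite_description.
  apply: (has_dim_bij (F := inv)).
  + by move=> a u v; apply: susp_inj; rewrite map_linear -!invE.
  + by move=> u v E; rewrite (invE u) E -invE.
  + by move=> w; exists (map_hom S w); apply: susp_inj; rewrite -invE.
Qed.

Lemma spherical_generator_susp x :
  spherical_generator x <-> spherical_generator (S x).
Proof.
have E i d : has_dim (hom_deg x x i) d <-> has_dim (hom_deg (S x) (S x) i) d.
  by case: i => n; rewrite /hom_deg -iterSr; exact: hom_susp_dim.
split=> -[sph gen]; split=> [i|P thP Px].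
- by apply/E; exact: sph.
- by apply: gen => //; case: thP => _ h _ _; apply/h.
- by apply/E; exact: sph.
- by apply: gen => //; case: thP => _ h _ _; apply: (h _).1.
Qed.

End Spherical.

Section AlmostSplit.
Variables (k : fieldType) (D : tricat k).
Implicit Types x y z : D.
Local Notation S := (susp D).
Local Notation "S1[ f ]" := (map_hom (susp D) f) (at level 0, f at level 99).
Variables (s : D) (om : hom s (S (S s))).
Hypotheses (splitD : split_idempotents D) (sph : sphere om).

(* Morphisms from indecomposables to y that are not split epimorphisms factor
   through g : e -> y, since to_detects makes c ** p : y -> S (S y) vanish on
   them. *)
Lemma almost_split_pred y (p : hom y s) (c : hom s (S (S y))) a z e
    (i : hom (S y) e) (g : hom e y) x (b : hom x y) :
  tower_obj om p -> S1[S1[p]] ** c = om -> dist i g (c ** p) ->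
  biproduct a z e -> scalar_end a -> scalar_end z ->
  indecomposable x -> rad b -> ~ rad2 b -> isomorphic x a \/ isomorphic x z.
Proof.
move=> ty Ec T [i1 [i2 [p1 [p2 [_ _ _ _ E1]]]]] Ea Ez ix rb nb.
apply: NNPP => nI; apply: nb.
have /dist_rotate T1 := T.
have cpb : (c ** p) ** b = 0.
  apply: (to_detects ty) => h; rewrite -compmA.
  have [l El] := to_end ty (b ** h).
  have [l0|l0] := eqVneq l 0; first by rewrite El l0 scale0r comp0r.
  (* Composing [b] with the isomorphism that radicality provides for [l^-1 *: h] gives zero. *)
  suff -> : b = 0 by rewrite comp0l comp0r.
  apply: (iso_cancelr (rb (l^-1 *: h))).
  by rewrite comp0l compBr compm1 compmA compZr El scalerA mulVf // scale1r comp1m subrr.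
have [w Ew] := dist_factor_l T1 cpb.
exists e, g, w; split=> //.
(* A nonzero scalar [g ** f] would force the connecting morphism [c ** p] to vanish. *)
- apply: comp0_rad => f; have [l El] := to_end ty (g ** f).
  have /eqP : (c ** p) ** (g ** f) = 0 by rewrite compmA (dist_comp0 T1) comp0l.
  rewrite El compZr compm1 scaler_eq0 => /orP [/eqP ->|/eqP cp0].
    by rewrite scale0r.
  by case: (to_socle ty Ec cp0).
- have r1 : rad (p1 ** w).
    by apply/comp0_rad/non_iso_rad => // I; apply: nI; left; exists (p1 ** w).
  have r2 : rad (p2 ** w).
    by apply/comp0_rad/non_iso_rad => // I; apply: nI; right; exists (p2 ** w).
  move=> f; rewrite -[w]comp1m -E1 compDl compDr -!compmA !(compmA f).
  exact: rad_sum_iso.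
Qed.

Section Ladder.
Variables (y y' z : D) (p : hom y s) (q : hom y' s) (q' : hom z s).
Variables (i : hom (S y) y') (i' : hom (S y') z).
Variables (c : hom s (S (S y))) (c' : hom s (S (S y'))) (r : hom y' y).
Hypotheses (ty : tower_obj om p) (Ec : S1[S1[p]] ** c = om) (T : dist i q c).
Hypotheses (Ec' : S1[S1[q]] ** c' = om) (T' : dist i' q' c') (Er : p ** r = q).

Let rc : S1[S1[r]] ** c' = c.
Proof.
apply/eqP; rewrite -subr_eq0; apply/eqP/(to_inj ty).
by rewrite compBr compmA -!map_comp Er Ec Ec' subrr.
Qed.

(** Since [S1[S1[r]]] carries [c'] to [c], it extends to a morphism of triangles that is the
    identity on [s]. *)
Lemma ladder_step : exists r' : hom z y', q ** r' = q'.
Proof.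
have /dist_rotate/dist_rotate T1 := T; have /dist_rotate/dist_rotate T1' := T'.
have E : S1[S1[r]] ** c' = c ** idm s by rewrite compm1.
have [e [_ Ee]] := dist_morphism T1' T1 E.
have [r' Er'] := susp_surj e; exists r'; apply: susp_inj.
move: Ee; rewrite map_id comp1m Er' compNl => /oppr_inj ->.
by rewrite map_comp.
Qed.

(** The octahedral axiom for the composite [c' ** q] puts the shift of [e] between those of [S y]
    and [z]. The connecting morphism is the shift of [c ** q'] up to sign, which is zero because [c]
    factors through [c']. *)
Lemma middle_term e (j : hom (S y') e) (g : hom e y') :
  dist j g (c' ** q) -> biproduct (S y) z e.
Proof.
move=> T''; have /dist_rotate T1 := T.
have /dist_rotate T1' := T'; have /dist_rotate T2' := T1'.
have /dist_rotate/dist_rotate T1'' := T''.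
have [u [v [Tuv _ _ _ _]]] := dist_octahedron T1 T2' T1''.
have E0 : S1[c] ** (- S1[q']) = 0.
  rewrite compNr -map_comp -rc -compmA (dist_comp0 T1') comp0r map0 oppr0 //.
move: Tuv; rewrite E0 => /split_triangle; exact: susp_biproduct.
Qed.

End Ladder.

(** At the bottom of the tower a zero object stands in for the second summand of the middle term. *)
Lemma first_middle_term (z : D) (i : hom (S s) z) (q : hom z s) (z0 : D) :
  is_zero z0 -> dist i q om -> dist i q (om ** idm s) /\ biproduct z0 z z.
Proof. by move=> Z T; rewrite compm1; split=> //; exact: biproduct_zerol. Qed.

Lemma dist_replace x y z y' (f : hom x y) (g : hom y z) (h : hom z (S x)) :
  dist f g h -> isomorphic y y' ->
  exists (f' : hom x y') (g' : hom y' z), dist f' g' h.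
Proof.
move=> T [phi Iphi]; have [psi [pp qq]] := Iphi; exists (phi ** f), (g ** psi).
apply: (dist_iso (iso_id _) Iphi (iso_id _) _ _ _ T).
- by rewrite compm1.
- by rewrite comp1m -compmA pp compm1.
- by rewrite map_id comp1m compm1.
Qed.

Lemma tower_nonzero y (p : hom y s) : tower_obj om p -> ~ is_zero y.
Proof.
move=> ty y0; have [c Ec] := to_lift ty.
by apply: (to_socle ty Ec); rewrite (from_zero p y0) comp0r.
Qed.

End AlmostSplit.

(** * The exchange relation at a tower object *)

Section Exchange.
Variables (k : fieldType) (D : tricat k) (F : fieldType) (rho : D -> F) (T : D -> Prop).
Local Notation S := (susp D).
Local Notation "S1[ f ]" := (map_hom (susp D) f) (at level 0, f at level 99).
Variables (s : D) (om : hom s (S (S s))).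
Hypotheses (cm : cluster_map T rho) (rho0 : forall d, rho d <> 0).

Lemma cluster_zero z : is_zero z -> rho z = 1.
Proof.
move=> z0; have := cluster_sum cm (biproduct_zerol z z0).
by rewrite -{1}[rho z]mulr1 => /mulfI ->//; exact/eqP.
Qed.

(** For the pair [S y], [y] the space Ext^1 is End(S y), a line; the second triangle is
    [y -> 0 -> S y], which contributes the summand 1. *)
Lemma tower_exchange y (p : hom y s) (c : hom s (S (S y))) a z e
    (i : hom (S y) e) (g : hom e y) :
  tower_obj om p -> S1[S1[p]] ** c = om -> dist i g (c ** p) -> biproduct a z e ->
  rho (S y) * rho y = rho a * rho z + 1.
Proof.
move=> ty Ec Tr B; have y0 := tower_nonzero ty.
have Sy0 : ~ is_zero (S y).
  by move=> Z; apply: y0; apply: susp_inj; rewrite map_id map0.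
have Ey := to_end ty.
have ESy : scalar_end (S y).
  move=> f; have [f' ->] := susp_surj f; have [l ->] := Ey f'.
  by exists l; rewrite mapZ map_id.
have [z0 Z] := (tri_additive D).1.
rewrite -(cluster_sum cm B) -(cluster_zero Z).
apply: (cluster_exchange cm).
- exact: scalar_end_indecomposable.
- exact: scalar_end_indecomposable.
- by apply/has_dim1; exists (idm _).
- by exists i, g, (c ** p); split=> //; exact: (to_socle ty Ec).
- exists 0, 0, (- S1[idm y]); split; last first.
    by rewrite map_id => /eqP; rewrite oppr_eq0 => /eqP.
  by apply/(dist_rotate (idm y) 0 0); exact: dist_id.
Qed.

End Exchange.

(** * Arcs *)

Fact arc_proof (i : int) (h : nat) : (i, i + 2 + h%:Z).1 <= (i, i + 2 + h%:Z).2 - 2.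
Proof. by rewrite /=; lia. Qed.

(** Coordinates by left end point and height [h], so that [h = 0] is the boundary of the quiver. *)
Definition arc (i : int) (h : nat) : zarc := exist _ (i, i + 2 + h%:Z) (arc_proof i h).

Lemma arcP (a : zarc) : exists i h, a = arc i h.
Proof.
case: a => -[i j] le; exists i, (absz (j - 2 - i)%R); apply: val_inj => /=.
by congr pair; rewrite /= in le; lia.
Qed.

Lemma arc_inj i j g h : arc i g = arc j h -> i = j /\ g = h.
Proof. by move=> /(congr1 val) /= [-> /addrI []]. Qed.

Lemma arrow_left i h : arc_arrow (arc (i - 1) h.+1) (arc i h).
Proof.
by apply/orP; right; apply/eqP; rewrite /=; congr pair; lia.
Qed.

Lemma arrow_right i h : arc_arrow (arc i h) (arc i h.+1).
Proof.
by apply/orP; left; apply/eqP; rewrite /=; congr pair; lia.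
Qed.

(* The arcs with right end point m + 2. *)
Definition coray (m : int) (h : nat) : zarc := arc (m - h%:Z) h.

Section Coordinates.
Variables (k : fieldType) (D : tricat k) (X : zarc -> D).
Hypotheses (splitD : split_idempotents D) (coordX : ar_coordinates X).
Local Notation S := (susp D).
Local Notation "S1[ f ]" := (map_hom (susp D) f) (at level 0, f at level 99).

Lemma susp_arc i h : isomorphic (S (X (arc i h))) (X (arc (i - 1) h)).
Proof. by apply: (ar_susp coordX); rewrite /=; congr pair; lia. Qed.

Lemma arrow_irr a b : arc_arrow a b -> exists2 f : hom (X a) (X b), rad f & ~ rad2 f.
Proof. by move=> ab; apply: irr_dim1; have := ar_arrows coordX a b; rewrite ab. Qed.

Section FirstStep.
Variables (a : zarc) (om : hom (X a) (S (S (X a)))).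
Variables (z : D) (i : hom (S (X a)) z) (q : hom z (X a)).
Hypotheses (sph : sphere om) (T : dist i q om).

Lemma first_tower : tower_obj om q.
Proof.
apply: (tower_step sph (tower_base sph) _ T).
by rewrite !map_id comp1m.
Qed.

(** The Auslander-Reiten triangle of a spherical object has indecomposable middle term, so there is
    only one predecessor in the quiver. *)
Lemma sphere_pred b : arc_arrow b a -> isomorphic (X b) z.
Proof.
move=> /arrow_irr [f rf nf]; have [z0 Z] := (tri_additive D).1.
have [T' B] := first_middle_term Z T.
have Ez0 : scalar_end z0 by move=> g; exists 0; rewrite (to_zero g Z) scale0r.
have Eom : S1[S1[idm (X a)]] ** om = om by rewrite !map_id comp1m.
have ib := ar_indec coordX b.
case: (almost_split_pred splitD (tower_base sph) Eom T' B Ez0 (to_end first_tower) ib rf nf) => //.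
by move=> /isomorphic_sym /iso_zero /(_ Z) /ib.1.
Qed.

End FirstStep.

(** Off the boundary a vertex has two distinct predecessors, against [sphere_pred]. *)
Lemma spherical_boundary i h : spherical_generator (X (arc i h)) -> h = 0%N.
Proof.
case: h => // h [sph gen]; have [om sphom] := sphereP sph gen.
have [z [j [q T]]] := cocone om.
have I1 := sphere_pred sphom T (arrow_left i h.+1).
have I2 := sphere_pred sphom T (arrow_right i h).
have /arc_inj [] := ar_inj coordX (isomorphic_trans I1 (isomorphic_sym I2)).
by lia.
Qed.

(** [s] lies on the boundary, and the boundary objects are shifts of one another. *)
Lemma spherical_arc (s : D) : spherical_generator s ->
  forall j, spherical_generator (X (arc j 0)).
Proof.
move=> sg; have [om [_ [id0 sp1] _ _ _]] := sphereP sg.1 sg.2.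
have s_ind : indecomposable s.
  by apply: scalar_end_indecomposable.
have [a Ia] := ar_surj coordX s_ind; have [i [h Ea]] := arcP a.
have sgi := spherical_generator_iso (isomorphic_sym Ia) sg.
move: sgi; rewrite Ea => sgi; have h0 := spherical_boundary sgi; rewrite h0 in sgi.
have step j : spherical_generator (X (arc j 0)) <-> spherical_generator (X (arc (j - 1) 0)).
  have I := susp_arc j 0; split=> [/spherical_generator_susp|] H.
    exact: spherical_generator_iso I H.
  by apply/spherical_generator_susp; apply: spherical_generator_iso (isomorphic_sym I) H.
have up n : spherical_generator (X (arc (i + n%:Z) 0)).
  elim: n => [|n IHn]; first by rewrite addr0.
  by apply/step; have -> : i + n.+1%:Z - 1 = i + n%:Z by lia.
have down n : spherical_generator (X (arc (i - n%:Z) 0)).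
  elim: n => [|n IHn]; first by rewrite subr0.
  have -> : i - n.+1%:Z = i - n%:Z - 1 by lia.
  exact: (step _).1 IHn.
move=> j; have [le|lt] := lerP i j.
  have -> : j = i + (absz (j - i)%R)%:Z by lia.
  exact: up.
have -> : j = i - (absz (j - i)%R)%:Z by lia.
exact: down.
Qed.

Section Ladder.
Variable m : int.
Local Notation A := (coray m).
Local Notation s := (X (A 0)).
Variable om : hom s (S (S s)).
Hypothesis sph : sphere om.

Lemma coray_arrow h : arc_arrow (A h.+1) (A h).
Proof.
rewrite /coray; have -> : m - h.+1%:Z = m - h%:Z - 1 by lia.
exact: arrow_left.
Qed.

Lemma susp_coray h : isomorphic (S (X (A h))) (X (arc (m - h.+1%:Z) h)).
Proof. by have := susp_arc (m - h%:Z) h; have -> : m - h%:Z - 1 = m - h.+1%:Z by lia. Qed.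

(** The invariant carried up the coray; [r] is the compatibility over [s] that [middle_term]
    needs. *)
Definition rung y y' : Prop :=
  exists (p : hom y s) (q : hom y' s) (i : hom (S y) y') (c : hom s (S (S y))) (r : hom y' y),
  [/\ tower_obj om p, S1[S1[p]] ** c = om, dist i q c & p ** r = q].

Definition exchange_data a y z : Prop :=
  exists e (p : hom y s) (c : hom s (S (S y))) (i : hom (S y) e) (g : hom e y),
  [/\ tower_obj om p, S1[S1[p]] ** c = om, dist i g (c ** p) & biproduct a z e].

Lemma rung0 z0 : is_zero z0 ->
  rung s (X (A 1)) /\ exchange_data z0 s (X (A 1)).
Proof.
move=> Z; have [z [j [q T]]] := cocone om.
have I : isomorphic (X (A 1)) z by apply: (sphere_pred sph T); exact: coray_arrow.
have [j' [q' T']] := dist_replace T (isomorphic_sym I).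
have ts := tower_base sph.
have E : S1[S1[idm s]] ** om = om by rewrite !map_id comp1m.
split; first by exists (idm s), q', j', om, q'; rewrite comp1m.
by have [T1 B] := first_middle_term Z T'; exists (X (A 1)), (idm s), om, j', q'.
Qed.

Lemma rung_step h : rung (X (A h)) (X (A h.+1)) ->
  rung (X (A h.+1)) (X (A h.+2)) /\
  exchange_data (S (X (A h))) (X (A h.+1)) (X (A h.+2)).
Proof.
case=> p [q [i [c [r [tp Ec T Er]]]]].
have tq := tower_step sph tp Ec T; have [d Ed] := to_lift tq.
have [z [i' [q' T']]] := cocone d; have tz := tower_step sph tq Ed T'.
(* A predecessor of [A h.+1] must be one of the two middle summands, and its coordinates differ from
   those of the summand [S (X (A h))]. *)
have I : isomorphic (X (A h.+2)) z.
  have [e [j [g Te]]] := cocone (d ** q).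
  have B := middle_term tp Ec T Ed T' Er Te.
  have ESy : scalar_end (S (X (A h))).
    move=> f; have [f' ->] := susp_surj f; have [l ->] := to_end tp f'.
    by exists l; rewrite mapZ map_id.
  have [f rf nf] := arrow_irr (coray_arrow h.+1).
  have ix := ar_indec coordX (A h.+2).
  case: (almost_split_pred splitD tq Ed Te B ESy (to_end tz) ix rf nf) => // J.
  have /arc_inj [] := ar_inj coordX (isomorphic_trans J (susp_coray h)).
  by lia.
have [i2 [q2 T2]] := dist_replace T' (isomorphic_sym I).
have [r2 Er2] := ladder_step tp Ec T Ed T2 Er.
have [e [j [g Te]]] := cocone (d ** q).
split; first by exists q, q2, i2, d, r2.
exists e, q, d, j, g; split=> //.
exact: (middle_term tp Ec T Ed T2 Er Te).
Qed.

Lemma rung_coray h : rung (X (A h)) (X (A h.+1)).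
Proof.
elim: h => [|h IHh]; last by case: (rung_step IHh).
by have [z0 Z] := (tri_additive D).1; case: (rung0 Z).
Qed.

(** The arcs [arc (m - j.+1%:Z) j] all end at [m + 1]. For [m = n - 1] they lie in the fan, which is
    why [a] is recorded in this form. *)
Lemma coray_exchange (F : fieldType) (rho : D -> F) (T : D -> Prop) h :
  cluster_map T rho -> (forall d, rho d <> 0) ->
  exists2 a, a = 1 \/ exists j, a = rho (X (arc (m - j.+1%:Z) j)) &
    rho (X (arc (m - h.+1%:Z) h)) * rho (X (A h)) = a * rho (X (A h.+1)) + 1.
Proof.
move=> cm rho0; have E j := cluster_iso cm (susp_coray j).
case: h => [|h]; rewrite -E.
  have [z0 Z] := (tri_additive D).1.
  have [_ [e [p [c [i [g [tp Ec T1 B]]]]]]] := rung0 Z.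
  exists 1; first by left.
  by rewrite (tower_exchange cm rho0 tp Ec T1 B) (cluster_zero cm rho0 Z).
have [_ [e [p [c [i [g [tp Ec T1 B]]]]]]] := rung_step (rung_coray h).
exists (rho (S (X (A h)))); first by right; exists h; rewrite E.
exact: (tower_exchange cm rho0 tp Ec T1 B).
Qed.

End Ladder.

End Coordinates.

(** * Specialisation of rational functions *)

Section Evaluation.
Variable I : choiceType.

(** The value of a monomial at the point all of whose coordinates are 1; [mmap] extends it to
    evaluation of polynomials there. *)
Definition unit_monomial (m : {cmonom I}) : rat := 1.

Lemma unit_monomial_mmorphism : mmorphism unit_monomial.
Proof. by split=> [m1 m2|] //; rewrite /unit_monomial mulr1. Qed.

HB.instance Definition _ :=
  isMultiplicative.Build {cmonom I} rat unit_monomial unit_monomial_mmorphism.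

Definition coef_sum : ratpoly I -> rat := mmap idfun unit_monomial.

Lemma coef_sumM p q : coef_sum (p * q) = coef_sum p * coef_sum q.
Proof. exact: rmorphM. Qed.

Lemma coef_sumD p q : coef_sum (p + q) = coef_sum p + coef_sum q.
Proof. exact: rmorphD. Qed.

Lemma coef_sum1 : coef_sum 1 = 1.
Proof. exact: rmorph1. Qed.

Lemma coef_sumU (m : {cmonom I}) : coef_sum << m >> = 1.
Proof. by rewrite /coef_sum mmapU mulr1. Qed.

(* The value of a fraction at the point all of whose coordinates are 1. *)
Definition value_at1 (f : ratfun I) (v : rat) : Prop :=
  exists p q : ratpoly I, [/\ f = tofrac p / tofrac q, coef_sum q = 1 & coef_sum p = v].

Lemma coef_sum_neq0 (q : ratpoly I) : coef_sum q = 1 -> tofrac q != 0.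
Proof.
move=> q1; rewrite tofrac_eq0; apply/eqP => q0; move: q1.
by rewrite q0 /coef_sum raddf0.
Qed.

Lemma cross_mul (F : fieldType) (a b c d : F) :
  b != 0 -> d != 0 -> a / b = c / d -> a * d = c * b.
Proof. by move=> b0 d0 /eqP; rewrite eqr_div // => /eqP. Qed.

Lemma value_at1_unique f v w : value_at1 f v -> value_at1 f w -> v = w.
Proof.
move=> [p [q [-> q1 <-]]] [p' [q' [E q1' <-]]].
have q0 := coef_sum_neq0 q1; have q'0 := coef_sum_neq0 q1'.
have /eqP := cross_mul q0 q'0 E; rewrite -!tofracM tofrac_eq => /eqP pq.
by rewrite -[LHS]mulr1 -q1' -coef_sumM pq coef_sumM q1 mulr1.
Qed.

Lemma value_at1_poly p : value_at1 (tofrac p) (coef_sum p).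
Proof. by exists p, 1; rewrite tofrac1 divr1 coef_sum1. Qed.

Lemma value_at1_1 : value_at1 1 1.
Proof. by have := value_at1_poly 1; rewrite tofrac1 coef_sum1. Qed.

Lemma value_at1_var i : value_at1 (ratfun_var i) 1.
Proof. by rewrite -[X in value_at1 _ X](coef_sumU (ucm i)); exact: value_at1_poly. Qed.

(* Explicit [tofracM] instead of rewriting: unification would unfold products of
   polynomials. *)
Lemma value_at1M f g v w : value_at1 f v -> value_at1 g w -> value_at1 (f * g) (v * w).
Proof.
move=> [p [q [-> q1 <-]]] [p' [q' [-> q1' <-]]]; exists (p * p'), (q * q').
split; [|by rewrite coef_sumM q1 q1' mulr1|exact: coef_sumM].
transitivity ((tofrac p * tofrac p') / (tofrac q * tofrac q')); first exact: mulf_div.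
by congr (_ / _); exact/esym/tofracM.
Qed.

Lemma value_at1D f g v w : value_at1 f v -> value_at1 g w -> value_at1 (f + g) (v + w).
Proof.
move=> [p [q [-> q1 <-]]] [p' [q' [-> q1' <-]]]; exists (p * q' + p' * q), (q * q').
split.
- transitivity ((tofrac p * tofrac q' + tofrac p' * tofrac q) / (tofrac q * tofrac q')).
    by apply: addf_div; exact: coef_sum_neq0.
  congr (_ / _); last exact/esym/tofracM.
  apply: etrans (esym (tofracD _ _)).
  by congr (_ + _); exact/esym/tofracM.
- by rewrite coef_sumM q1 q1' mulr1.
- apply: etrans (coef_sumD _ _) _; congr (_ + _).
    by rewrite coef_sumM q1' mulr1.
  by rewrite coef_sumM q1 mulr1.
Qed.

(** The monomial denominator has value 1, so the value is a nonempty sum of positive integer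
    coefficients. *)
Lemma value_at1_positive f : f <> 0 -> is_laurent f -> positive_numerators f ->
  exists w : nat, value_at1 f w.+1%:R.
Proof.
move=> f0 [p [m E]] /(_ _ _ E) pos.
suff [w Ew] : exists w : nat, coef_sum p = w.+1%:R.
  by exists w, p, << m >>; rewrite coef_sumU.
have p0 : enum_fset (msupp p) != [::].
  apply/eqP => s0; apply: f0; rewrite E (_ : p = 0) ?tofrac0 ?mul0r //.
  apply/malgP => mu; rewrite mcoeff0; apply: mcoeff_outdom.
  by apply/negP => /=; rewrite -[mu \in _]/(mu \in enum_fset (msupp p)) s0.
rewrite /coef_sum /mmap; move: pos p0.
(* Each coefficient is at least 1, so the sum is at least the number of monomials. *)
suff sum_pos (l : seq {cmonom I}) :
    (forall mu, mu \in l -> exists2 c : nat, (0 < c)%N & p@_mu = c%:R) ->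
    exists w : nat, \sum_(mu <- l) idfun p@_mu * unit_monomial mu = (size l + w)%:R.
  move=> pos p0; have [w ->] := sum_pos (enum_fset (msupp p)) pos.
  by case: (enum_fset (msupp p)) p0 => //= mu l _; exists (size l + w)%N.
elim: l => [|mu l IHl] pos; first by exists 0%N; rewrite big_nil.
have [|w Ew] := IHl; first by move=> nu lnu; apply: pos; rewrite inE lnu orbT.
have [[//|c] _ Ec] := pos mu (mem_head _ _).
by exists (c + w)%N; rewrite big_cons Ew /= Ec mulr1 -natrD; congr _%:R; lia.
Qed.

End Evaluation.

(** * Infinite descent on the values at 1 *)

Theorem theorem6p10
  (k : closedFieldType) (D : tricat k) (s : D)
  (algD : algebraic D) (splitD : split_idempotents D)
  (sph_s : spherical2 s) (gen_s : classical_generator s)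
  (X : zarc -> D) (coordX : ar_coordinates X)
  (n : int) (T : D -> Prop) (ctT : cluster_tilting T)
  (indT : forall a : zarc, T (X a) <-> fan n a) :
  ~ exists rho : D -> ratfun (fan_arc n),
      [/\ cluster_map T rho,
          forall t : fan_arc n, rho (X (val t)) = ratfun_var t,
          forall d : D, rho d <> 0 /\ is_laurent (rho d)
        & forall d : D, positive_numerators (rho d)].
Proof.
case=> rho [cm rho_var laurent pos].
have rho0 d : rho d <> 0 by case: (laurent d).
(* The base of the tower is the arc (n - 1, n + 1), so that the shifts of the tower objects end at
   [n]. *)
have [sph gen] := spherical_arc splitD coordX (conj sph_s gen_s) (n - 1 - 0%:Z).
have [om sphom] := sphereP sph gen.
have value_fan h : value_at1 (rho (X (arc (n - 1 - h.+1%:Z) h))) 1.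
  have fan_a : fan n (arc (n - 1 - h.+1%:Z) h).
    by apply/orP; left; apply/eqP => /=; lia.
  pose t : fan_arc n := exist (fun a => fan n a) (arc (n - 1 - h.+1%:Z) h) fan_a.
  by have := value_at1_var t; rewrite -rho_var.
have value h : exists w : nat, value_at1 (rho (X (coray (n - 1) h))) w.+1%:R.
  by apply: value_at1_positive => //; case: (laurent (X (coray (n - 1) h))).
suff no_value : forall w h, ~ value_at1 (rho (X (coray (n - 1) h))) w.+1%:R.
  by have [w] := value 0%N; exact: no_value.
(* With value 1 for both fan factors the exchange relation reads v + 1 = (w + 1) + 1. *)
have descent h v w : value_at1 (rho (X (coray (n - 1) h))) v.+1%:R ->
    value_at1 (rho (X (coray (n - 1) h.+1))) w.+1%:R -> v = w.+1.
  have [a Ha Ea] := coray_exchange splitD coordX sphom h cm rho0.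
  have Va : value_at1 a 1.
    by case: Ha => [->|[j ->]]; [exact: value_at1_1|exact: value_fan].
  move=> Vv Vw; have := value_at1M (value_fan h) Vv.
  rewrite Ea => /value_at1_unique /(_ (value_at1D (value_at1M Va Vw) (value_at1_1 _))).
  by rewrite !mul1r -(natrD _ w.+1 1) => /eqP; rewrite eqr_nat addn1 => /eqP [].
(* Induction on the value for all [h] at once: going from [h] to [h.+1] lowers it by one. *)
elim=> [|w IHw] h Vh; have [w' Vh'] := value h.+1; have := descent _ _ _ Vh Vh' => //.
by case=> E; apply: (IHw h.+1); rewrite E.
Qed.
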